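(* Let $(\Sigma,g,j)$ be the Euclidean plane $\mathbb{R}^2$ endowed with its canonical inner product $\langle\cdot,\cdot\rangle$ and the complex structure $j(x_1,x_2)=(-x_2,x_1)$. Then the metric $\mathbb{G}$ on $T\mathbb{R}^2\simeq\mathbb{R}^4$ is the flat pseudo-metric of signature $(2,2)$. Moreover, if $L$ is a (non-null) rank two minimal Lagrangian surface of $(T\mathbb{R}^2,\mathbb{J},\mathbb{G},\Omega)$, then, locally, it is parametrized by $X(p)=(p,\nabla u(p))$, where the real map $u$ takes the form $$u(p)=f_1(\langle p,V\rangle)+f_2(\langle p,jV\rangle),$$ where $V$ is some constant unit vector of $\mathbb{R}^2$ and $f_1$ and $f_2$ are two non-constant functions of the real variable of class $C^2$.
   Context: On $T\mathbb{R}^2=\mathbb{R}^2\times\mathbb{R}^2$ with base coordinates $(x_1,x_2)$ and fibre coordinates $(y_1,y_2)$, write a tangent vector as $X=(PX,KX)\in\mathbb{R}^2\times\mathbb{R}^2$ (base part, fibre part). Then $\Omega(X,Y)=\langle KX,PY\rangle-\langle PX,KY\rangle$, i.e. $\Omega=dy_1\wedge dx_1+dy_2\wedge dx_2$; $\mathbb{J}=j\oplus j$; and $\mathbb{G}(X,Y)=\Omega(\mathbb{J}X,Y)$. A surface $L$ of $T\mathbb{R}^2$ is Lagrangian if $\Omega$ restricts to zero on $L$; it has rank two if the restriction to $L$ of the projection $\pi:T\mathbb{R}^2\to\mathbb{R}^2$, $(x,y)\mapsto x$, has rank two; it is non-null if the metric induced by $\mathbb{G}$ on $L$ is non-degenerate.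 For a non-null surface the mean curvature vector $\vec H$ is one half of the trace, with respect to the induced metric, of the second fundamental form of $L$ in $(T\mathbb{R}^2,\mathbb{G})$; $L$ is minimal if $\vec H=0$. $\nabla u$ denotes the Euclidean gradient of $u$.
   Formalization: ''Non-constant'' is required of f_1, f_2 on the whole real line, not on the values taken by <p,V>, <p,jV> near the point; there one of them may be constant, as for u(p)=p_2^2/2. *)

(* Defs.v *)
From HB Require Import structures.
From mathcomp Require Import all_boot all_order all_algebra.
From mathcomp Require Import all_classical all_reals all_analysis.

Set Implicit Arguments.
Unset Strict Implicit.
Unset Printing Implicit Defensive.

Import Order.TTheory GRing.Theory Num.Theory.
Import numFieldNormedType.Exports.

Local Open Scope classical_set_scope.
Local Open Scope ring_scope.

(* Meant for an open set [U]; in finite dimension this is the usual class C^k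
   on [U]. *)
Fixpoint class_C (R : realType) (V W : normedModType R) (k : nat)
    (U : set V) (f : V -> W) : Prop :=
  if k is k'.+1 then
    (forall x, U x -> differentiable f x) /\
    (forall v, class_C k' U ('D_v f))
  else forall x, U x -> {for x, continuous f}.

Definition stdvec (R : realType) (n : nat) (i : 'I_n) : 'rV[R]_n :=
  delta_mx 0 i.

Section PseudoRiemannian.
Variables (R : realType) (n : nat).

(* [g q X Y] is the product at the point [q] of R^n of the tangent vectors
   [X] and [Y]. *)
Implicit Types (g : 'rV[R]_n -> 'rV[R]_n -> 'rV[R]_n -> R) (q X Y : 'rV[R]_n).

Definition metric_mx g q : 'M[R]_n :=
  \matrix_(i, j) g q (stdvec R i) (stdvec R j).

Definition pseudo_metric g : Prop :=
  [/\ forall q X, scalar (g q X),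
      forall q X Y, g q X Y = g q Y X,
      forall q, metric_mx g q \in unitmx
    & forall k X Y, class_C k setT (fun q => g q X Y : R^o)].

(* \Gamma^k_{ij} *)
Definition christoffel g (i j k : 'I_n) q : R :=
  2^-1 * \sum_(l < n) invmx (metric_mx g q) k l *
    ('D_(stdvec R i) (fun q' => metric_mx g q' j l : R^o) q
     + 'D_(stdvec R j) (fun q' => metric_mx g q' i l : R^o) q
     - 'D_(stdvec R l) (fun q' => metric_mx g q' i j : R^o) q).

(* R^l_{kij}, the component along the l-th coordinate of
   (\nabla_i \nabla_j - \nabla_j \nabla_i) \partial_k *)
Definition curvature g (l k i j : 'I_n) q : R :=
  'D_(stdvec R i) (christoffel g j k l : 'rV[R]_n -> R^o) q
  - 'D_(stdvec R j) (christoffel g i k l : 'rV[R]_n -> R^o) q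
  + \sum_(m < n) (christoffel g i m l q * christoffel g j k m q
                  - christoffel g j m l q * christoffel g i k m q).

Definition flat g : Prop := forall l k i j q, curvature g l k i j q = 0.

(* The bilinear term by which the Levi-Civita derivative differs from the
   coordinatewise one. *)
Definition levi_civita_term g q X Y : 'rV[R]_n :=
  \row_k \sum_(i < n) \sum_(j < n) christoffel g i j k q * X 0 i * Y 0 j.

Section ParametrizedSurface.
Variables (g : 'rV[R]_n -> 'rV[R]_n -> 'rV[R]_n -> R)
          (F : 'rV[R]_2 -> 'rV[R]_n).

Definition partial (i : 'I_2) (p : 'rV[R]_2) : 'rV[R]_n := 'D_(stdvec R i) F p.

Definition induced_mx (p : 'rV[R]_2) : 'M[R]_2 :=
  \matrix_(i, j) g (F p) (partial i p) (partial j p).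

(* \nabla_{\partial_i F} \partial_j F for the Levi-Civita connection of [g] *)
Definition cov_partial (i j : 'I_2) (p : 'rV[R]_2) : 'rV[R]_n :=
  'D_(stdvec R i) (partial j) p
  + levi_civita_term g (F p) (partial i p) (partial j p).

(* The [g]-orthogonal projection on the tangent plane, when the induced metric
   is non-degenerate. *)
Definition tangent_part (p : 'rV[R]_2) (Z : 'rV[R]_n) : 'rV[R]_n :=
  \sum_(i < 2) \sum_(j < 2)
    (invmx (induced_mx p) i j * g (F p) Z (partial i p)) *: partial j p.

Definition second_ff (i j : 'I_2) (p : 'rV[R]_2) : 'rV[R]_n :=
  cov_partial i j p - tangent_part p (cov_partial i j p).

Definition mean_curvature (p : 'rV[R]_2) : 'rV[R]_n :=
  2^-1 *: \sum_(i < 2) \sum_(j < 2)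
    invmx (induced_mx p) i j *: second_ff i j p.

End ParametrizedSurface.
End PseudoRiemannian.

Definition has_signature (R : realType) (r s : nat) (A : 'M[R]_(r + s)) : Prop :=
  exists2 B : 'M[R]_(r + s), B \in unitmx &
    B *m A *m B^T = block_mx 1%:M 0 0 (- 1%:M).

Section TangentBundle.
Variable R : realType.

Definition inner (v w : 'rV[R]_2) : R := \sum_(i < 2) v 0 i * w 0 i.

Definition jrot (v : 'rV[R]_2) : 'rV[R]_2 :=
  \row_(i < 2) if i == 0 then - v 0 1 else v 0 0.

(* TR^2 is R^(2 + 2), a point being [row_mx x y] with base point [x] and fibre
   part [y]; the tangent space at any point is identified with R^(2 + 2), the
   base and fibre parts PX and KX of a tangent vector being as follows. *)
Definition basepart (X : 'rV[R]_(2 + 2)) : 'rV[R]_2 := lsubmx X.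
Definition fibrepart (X : 'rV[R]_(2 + 2)) : 'rV[R]_2 := rsubmx X.

Definition Omega (X Y : 'rV[R]_(2 + 2)) : R :=
  inner (fibrepart X) (basepart Y) - inner (basepart X) (fibrepart Y).

Definition JJ (X : 'rV[R]_(2 + 2)) : 'rV[R]_(2 + 2) :=
  row_mx (jrot (basepart X)) (jrot (fibrepart X)).

(* Constant coefficients: the value does not depend on the point [q]. *)
Definition GG (q X Y : 'rV[R]_(2 + 2)) : R := Omega (JJ X) Y.

(* [F], on [U], is a regular C^2 parametrization of the piece [L `&` O] of [L]
   and a homeomorphism onto it. *)
Definition chart (L : set 'rV[R]_(2 + 2)) (U : set 'rV[R]_2)
    (O : set 'rV[R]_(2 + 2)) (F : 'rV[R]_2 -> 'rV[R]_(2 + 2)) : Prop :=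
  [/\ open U /\ open O,
      class_C 2 U F,
      forall p, U p -> \rank ('J F p) = 2%N,
      F @` U = L `&` O
    & exists2 Finv : 'rV[R]_(2 + 2) -> 'rV[R]_2,
        {within L `&` O, continuous Finv} & forall p, U p -> Finv (F p) = p].

Definition surface (L : set 'rV[R]_(2 + 2)) : Prop :=
  forall q, L q -> exists U O F, chart L U O F /\ O q.

(* A property of [L] at a point is read in every chart around that point. *)
Definition lagrangian (L : set 'rV[R]_(2 + 2)) : Prop :=
  forall U O F, chart L U O F -> forall p, U p ->
    forall v w : 'rV[R]_2, Omega ('D_v F p) ('D_w F p) = 0.

Definition rank_two (L : set 'rV[R]_(2 + 2)) : Prop :=
  forall U O F, chart L U O F -> forall p, U p ->
    \rank ('J (basepart \o F) p) = 2%N.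

Definition non_null (L : set 'rV[R]_(2 + 2)) : Prop :=
  forall U O F, chart L U O F -> forall p, U p ->
    induced_mx GG F p \in unitmx.

Definition minimal (L : set 'rV[R]_(2 + 2)) : Prop :=
  forall U O F, chart L U O F -> forall p, U p -> mean_curvature GG F p = 0.

Definition grad (u : 'rV[R]_2 -> R) (p : 'rV[R]_2) : 'rV[R]_2 :=
  \row_(i < 2) 'D_(stdvec R i) (u : 'rV[R]_2 -> R^o) p.

(* Non-constant on the whole real line, not on each interval: for the minimal
   surface generated by u(p) = p_2 ^ 2 / 2 one of the two functions in the
   decomposition of u is necessarily constant near each point. *)
Definition nonconstant (f : R -> R) : Prop := exists s t, f s <> f t.

End TangentBundle.

(* Main.v *)
Require Import Defs.
From HB Require Import structures.
From mathcomp Require Import all_boot all_order all_algebra.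
From mathcomp Require Import all_classical all_reals all_analysis.
From mathcomp Require Import ring lra.

Set Implicit Arguments.
Unset Strict Implicit.
Unset Printing Implicit Defensive.

Import Order.TTheory GRing.Theory Num.Theory.
Import numFieldNormedType.Exports.

Local Open Scope classical_set_scope.
Local Open Scope ring_scope.

(** Where L is the graph of [grad u], theta is 2 u_12 + i (u_22 - u_11): it carries the traceless
    part of the Hessian of u, and [V] and [jrot V] are eigenvectors of this Hessian. Non-nullity
    says that the two eigenvalues differ, and H = 0 that the eigendirections do not turn; the mixed
    derivative of u along [V] and [jrot V] then vanishes, which is the splitting into f1 and f2.
    Regularity shapes the proof. H uses both derivatives of a C^2 chart, so theta is only known to
    be C^1 and the equation for its argument cannot be differentiated again. All identities are
    therefore proved in the chart F, without passing to a graph; [basepart \o F] is inverted by a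
    Lipschitz section, and the composites with this section are differentiated along lines, by
    strict differentiability. The other constraint is that f1 and f2 have to be C^2 and nonconstant
    on the whole line, while L determines their derivatives only on small intervals; the germs are
    extended by clamping and modified away from these intervals. *)

(* Let F be a chart of L, with first partial derivatives X and Y, and let
   phi = basepart o F and psi = fibrepart o F.  For the complex coordinates
   z1 = x1 + i x2 and z2 = y1 + i y2 on TR^2, put theta = (dz1 /\ dz2)(X, Y).  On
   a Lagrangian surface the Gram determinant of (X, Y) is - |theta|^2, and H = 0
   says, by the symmetry of second derivatives, that Im (conj theta . d theta) = 0.
   Thus theta does not vanish and its argument is locally constant, which yields
   a unit vector V with d<psi, V> /\ d<phi, V> = 0 and d<psi, jV> /\ d<phi, jV> = 0.
   Since phi is a local diffeomorphism, <psi, V> o phi^-1 is a C^1 function of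
   <x, V> alone, and likewise for jV; f1 and f2 are primitives of these functions. *)

(** * Calculus in normed modules *)

Section Lines.
Variables (R : realType) (V W : normedModType R).

Lemma derive_line (f : V -> W) x v (t : R) :
  'D_1 (fun s : R => f (x + s *: v)) t = 'D_v f (x + t *: v) /\
  (derivable f (x + t *: v) v -> derivable (fun s : R => f (x + s *: v)) t 1).
Proof.
rewrite /derivable /derive.
suff -> : (fun h : R => h^-1 *:
    (((fun s : R => f (x + s *: v)) \o shift t) (h *: 1) - f (x + t *: v)))
  = (fun h => h^-1 *: ((f \o shift (x + t *: v)) (h *: v) - f (x + t *: v))) by [].
apply/funext => h /=; congr (_ *: (f _ - _)).
by rewrite [h *: 1]mulr1 scalerDl addrCA.
Qed.

Lemma is_derive_line (f : V -> W) x v (t : R) : differentiable f (x + t *: v) ->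
  is_derive t 1 (fun s : R => f (x + s *: v)) ('D_v f (x + t *: v)).
Proof.
by move=> df; have [<- fd] := derive_line f x v t; apply/derivableP/fd/diff_derivable.
Qed.

Lemma deriveZv (f : V -> W) x v (a : R) : differentiable f x ->
  'D_(a *: v) f x = a *: 'D_v f x.
Proof. by move=> df; rewrite !deriveE// linearZ. Qed.

Lemma derive_comp_shift (f : V -> W) x v c :
  'D_v (f \o shift c) x = 'D_v f (x + c).
Proof.
rewrite /derive.
suff -> : (fun h => h^-1 *: (((f \o shift c) \o shift x) (h *: v) - (f \o shift c) x))
  = (fun h => h^-1 *: ((f \o shift (x + c)) (h *: v) - f (x + c))) by [].
by apply/funext => h /=; rewrite addrA.
Qed.

End Lines.

Lemma segment_MVT (R : realType) (V : normedModType R) (f : V -> R^o) x v :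
  (forall t : R, 0 <= t <= 1 -> differentiable f (x + t *: v)) ->
  exists2 t : R, 0 <= t <= 1 & f (x + v) - f x = 'D_v f (x + t *: v).
Proof.
move=> df; pose g (s : R) : R^o := f (x + s *: v).
have gd (t : R) : 0 <= t <= 1 -> is_derive t 1 g ('D_v f (x + t *: v)).
  by move=> /df; exact: is_derive_line.
have [|||t t01 e] := @MVT_segment R g (fun t : R => 'D_v f (x + t *: v)) 0 1.
- exact: ler01.
- by move=> t; rewrite in_itv/= => /andP[t0 t1]; apply: gd; rewrite !ltW.
- apply: derivable_within_continuous => t; rewrite in_itv/= => t01.
  by have [] := gd _ t01.
exists t; first by move: t01; rewrite in_itv.
by rewrite subr0 mulr1 /g scale1r scale0r addr0 in e.
Qed.

Lemma ball_line (R : realType) (V : normedModType R) (p x : V) v (r t : R) :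
  ball p r x -> ball p r (x + v) -> 0 <= t <= 1 -> ball p r (x + t *: v).
Proof.
rewrite -ball_normE/= => px pv /andP[t0 t1].
have -> : p - (x + t *: v) = (1 - t) *: (p - x) + t *: (p - (x + v)).
  rewrite [- (x + v)]opprD addrA [t *: (_ - v)]scalerBr addrA -scalerDl subrK scale1r.
  by rewrite opprD addrA.
rewrite (le_lt_trans (ler_normD _ _))// !normrZ !ger0_norm// ?subr_ge0//.
have [->|tn0] := eqVneq t 0; first by rewrite subr0 mul1r mul0r addr0.
have tp : 0 < t by rewrite lt_neqAle eq_sym tn0.
rewrite [ltRHS](_ : r = (1 - t) * r + t * r); last by ring.
by rewrite ler_ltD// ?ltr_pM2l// ler_wpM2l// ?subr_ge0// ltW.
Qed.

Section Regularity.
Variables (R : realType) (V W : normedModType R).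
Implicit Types (U : set V) (f g : V -> W).

Lemma near_eq_differentiable f g x :
  (\near x, f x = g x) -> differentiable f x -> differentiable g x.
Proof.
move=> fg df.
have gd : g \o shift x = cst (g x) + 'd f x +o_ 0 id.
  have /eqaddoP fo := diff_locally df.
  apply/eqaddoP => e /fo; apply: filter_app.
  have fgx : \forall h \near 0, f (h + x) = g (h + x).
    by move: fg; rewrite (near_shift 0) /= subr0.
  by near=> h; rewrite !fctE/= (near fgx)// (nbhs_singleton fg).
have dgE : 'd g x = 'd f x :> (V -> W).
  by apply: diff_unique => //; exact: diff_continuous.
by apply/diff_locallyP; rewrite dgE; split=> //; exact: diff_continuous.
Unshelve. all: by end_near. Qed.

Lemma open_near_eq U f g x : open U -> (forall x, U x -> f x = g x) -> U x ->
  \near x, f x = g x.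
Proof.
by move=> oU fg Ux; near=> z; apply: fg; near: z; exact: open_nbhs_nbhs.
Unshelve. all: by end_near. Qed.

(** ['D_v f] is a total function, but formulas for it are known only on [U]. As [U] is open,
    agreement on [U] is agreement of germs, which passes to derivatives of every order. *)
Lemma eq_class_C k U f g : open U ->
  (forall x, U x -> f x = g x) -> class_C k U f -> class_C k U g.
Proof.
move=> oU; elim: k f g => [|k IH] f g fg /=.
  move=> fc x Ux; rewrite /prop_for /continuous_at -(fg x Ux).
  by apply: cvg_trans (fc x Ux); apply: near_eq_cvg; exact: open_near_eq fg Ux.
move=> [df Df]; split=> [x Ux|v].
  exact: near_eq_differentiable (open_near_eq oU fg Ux) (df _ Ux).
by apply: IH (Df v) => x Ux; exact/near_eq_derive/(open_near_eq oU fg Ux).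
Qed.

Lemma class_CW k U f : class_C k.+1 U f -> class_C k U f.
Proof.
elim: k f => [|k IH] f [df Df]; first by move=> x Ux; exact/differentiable_continuous/df.
by split=> // v; apply: IH.
Qed.

End Regularity.

Section LinearComposition.
Variables (R : realType) (V W X : normedModType R) (L : W -> X).
Hypotheses (Ll : linear L) (Lc : continuous L).

(** Linearity is kept as an unbundled hypothesis, so that coordinates and inner products with a
    fixed vector can serve as [L]; the bundled structure is rebuilt here once. *)
Lemma is_diff_linear y : is_diff y L L.
Proof.
pose M : {linear W -> X} := HB.pack L (GRing.isLinear.Build R W X *:%R L Ll).
by split; [exact: (linear_differentiable (f := M))|exact: (diff_lin (f := M))].
Qed.

Lemma differentiable_linear_comp (f : V -> W) x :
  differentiable f x -> differentiable (L \o f) x.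
Proof.
by move=> df; apply: differentiable_comp => //; have [] := is_diff_linear (f x).
Qed.

Lemma derive_linear_comp (f : V -> W) x v : differentiable f x ->
  'D_v (L \o f) x = L ('D_v f x).
Proof.
move=> df; have [Ld LE] := is_diff_linear (f x).
rewrite (deriveE _ (differentiable_linear_comp df)) (deriveE _ df).
by rewrite (diff_comp df Ld) LE.
Qed.

Lemma class_C_linear_comp k (U : set V) (f : V -> W) :
  open U -> class_C k U f -> class_C k U (L \o f).
Proof.
move=> oU; elim: k f => [|k IH] f /=.
  by move=> fc x Ux; apply: continuous_comp; [exact: fc|exact: Lc].
move=> [df Df]; split=> [x Ux|v]; first exact/differentiable_linear_comp/df.
by apply: eq_class_C (IH _ (Df v)) => // x Ux; rewrite derive_linear_comp//; exact: df.
Qed.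

End LinearComposition.

Section Schwarz.
Variables (R : realType) (V : normedModType R).
Implicit Types (U : set V) (f : V -> R^o).

(** Two applications of the mean value theorem: to h(x) = f(x + s w) - f(x) along v, then to
    ['D_v f] along w. The ball in the hypothesis contains the whole parallelogram. *)
Lemma double_difference U f (p v w : V) (s : R) :
  class_C 2 U f -> 0 < s -> [set x | `|x - p| <= s * (`|v| + `|w|)] `<=` U ->
  exists2 a, `|a - p| <= s * (`|v| + `|w|) &
    f (p + s *: v + s *: w) - f (p + s *: v) - (f (p + s *: w) - f p)
    = s ^+ 2 * 'D_w ('D_v f) a.
Proof.
move=> [df Df] s0 sU; pose h := (f \o shift (s *: w)) - f.
have near_p (t u : R) : 0 <= t <= 1 -> 0 <= u <= 1 ->
    `|p + t *: (s *: v) + u *: (s *: w) - p| <= s * (`|v| + `|w|).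
  move=> /andP[t0 t1] /andP[u0 u1].
  rewrite addrAC [p + _ - p]addrAC subrr add0r.
  rewrite (le_trans (ler_normD _ _))// !normrZ mulrDr.
  rewrite !(ger0_norm t0, ger0_norm u0, gtr0_norm s0).
  by rewrite lerD// ler_piMl// mulr_ge0// ltW.
have U_near t u : 0 <= t <= 1 -> 0 <= u <= 1 -> U (p + t *: (s *: v) + u *: (s *: w)).
  by move=> ? ?; exact/sU/near_p.
have i0 : 0 <= (0 : R) <= 1 by lra.
have i1 : 0 <= (1 : R) <= 1 by lra.
have dfs (t : R) : 0 <= t <= 1 -> differentiable f (p + t *: (s *: v)).
  by move=> t01; apply: df; rewrite -[X in U X]addr0 -(scale0r (s *: w)); exact: U_near.
have dfsw (t : R) : 0 <= t <= 1 ->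
    differentiable (f \o shift (s *: w)) (p + t *: (s *: v)).
  move=> t01; apply: differentiable_comp; first exact: ex_diff.
  by apply: df; rewrite /= -[X in _ + X]scale1r; exact: U_near.
have [t t01] : exists2 t : R, 0 <= t <= 1 &
    h (p + s *: v) - h p = 'D_(s *: v) h (p + t *: (s *: v)).
  by apply: segment_MVT => t t01; apply: differentiableB; [exact: dfsw|exact: dfs].
set x := p + t *: (s *: v) => hE.
have dDf u : 0 <= u <= 1 -> differentiable ('D_v f : V -> R^o) (x + u *: (s *: w)).
  by move=> u01; apply: (Df v).1; exact: U_near.
have [u u01] := segment_MVT dDf.
move=> Dh; exists (x + u *: (s *: w)); first exact: near_p.
have dfx := dfs _ t01; have dfwx := dfsw _ t01.
have -> : f (p + s *: v + s *: w) - f (p + s *: v) - (f (p + s *: w) - f p) =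
  h (p + s *: v) - h p by [].
have dhx : differentiable h x := differentiableB dfwx dfx.
rewrite hE (deriveZv _ _ dhx) (deriveB (diff_derivable dfwx) (diff_derivable dfx)).
rewrite derive_comp_shift Dh (deriveZv _ _ (dDf _ u01)).
by rewrite scalerA.
Qed.

(** The double difference is symmetric in v and w. Divided by s^2 it is one mixed derivative at a
    point a and the other at a point b; both points lie near p, where the two mixed derivatives are
    continuous. *)
Lemma class_C2_derive_comm U f p v w : open U -> U p -> class_C 2 U f ->
  'D_w ('D_v f) p = 'D_v ('D_w f) p.
Proof.
move=> oU Up fC2; have [_ Df] := fC2.
have cvw : {for p, continuous ('D_w ('D_v f) : V -> R^o)} by exact: (Df v).2.
have cwv : {for p, continuous ('D_v ('D_w f) : V -> R^o)} by exact: (Df w).2.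
apply/subr0_eq/normr0_eq0/eqP; rewrite eq_le normr_ge0 andbT.
apply/ler_addgt0Pl => e e0; rewrite addr0.
have e2 : 0 < e / 2 by rewrite divr_gt0.
have nU : nbhs p U by exact: open_nbhs_nbhs.
have near_vw : \forall a \near p, `|'D_w ('D_v f) p - 'D_w ('D_v f) a| <= e / 2.
  by move/cvgrPdist_le : cvw => /(_ _ e2).
have near_wv : \forall a \near p, `|'D_v ('D_w f) p - 'D_v ('D_w f) a| <= e / 2.
  by move/cvgrPdist_le : cwv => /(_ _ e2).
have : \forall a \near p, [/\ U a, `|'D_w ('D_v f) p - 'D_w ('D_v f) a| <= e / 2
    & `|'D_v ('D_w f) p - 'D_v ('D_w f) a| <= e / 2].
  by apply: filterS3 nU near_vw near_wv => a Ua ? ?; split.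
move=> /nbhs_ballP[r /= r0 rP].
(* The summand 1 keeps the denominator positive when v = w = 0. *)
pose s := r / 2 / (`|v| + `|w| + 1).
have vw1 : 0 < `|v| + `|w| + 1 by rewrite ltr_wpDl// addr_ge0.
have s0 : 0 < s by rewrite !divr_gt0.
have sr : s * (`|v| + `|w|) < r.
  have n0 : 0 <= `|v| + `|w| by rewrite addr_ge0.
  rewrite /s mulrAC ltr_pdivrMr//; move: (`|v| + `|w|) n0 => n n0.
  by have := mulr_ge0 (ltW r0) n0; nra.
have sP a : `|a - p| <= s * (`|v| + `|w|) -> ball p r a.
  by move=> ad; rewrite -ball_normE/= distrC (le_lt_trans ad).
have sU : [set x | `|x - p| <= s * (`|v| + `|w|)] `<=` U.
  by move=> a /sP/rP[].
have [a /sP/rP[_ ae _] aE] := double_difference fC2 s0 sU.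
rewrite [`|v| + _]addrC in sU sP.
have [b /sP/rP[_ _ be] bE] := double_difference fC2 s0 sU.
move: ('D_w ('D_v f) p) ('D_v ('D_w f) p) ('D_w ('D_v f) a) ('D_v ('D_w f) b) ae aE be bE.
move=> P Q A B PA AE QB BE.
have AB : A = B.
  have swap (x y z t : R) : x - y - (z - t) = x - z - (y - t) by ring.
  apply: (@mulfI _ (s ^+ 2)); first by rewrite expf_neq0// gt_eqF.
  by move: BE; rewrite -AE [p + s *: w + s *: v]addrAC => <-; exact: swap.
rewrite -(subrKA A) [leRHS]splitr (le_trans (ler_normD _ _))//.
by rewrite lerD// AB distrC.
Unshelve. all: by end_near. Qed.
End Schwarz.

(** * The inverse function theorem *)

Section StrictDifferentiability.
Variables (R : realType) (n : nat).
Implicit Types (U : set 'rV[R]_n) (p v : 'rV[R]_n).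

Lemma rV_coord_le v j : `|v 0 j| <= `|v|.
Proof.
rewrite [leRHS]/Num.Def.normr/= mx_normrE.
exact: (le_bigmax _ (fun ij : 'I_1 * 'I_n => `|v ij.1 ij.2|) (0, j)).
Qed.

Lemma rV_norm_le v (c : R) : 0 <= c -> (forall j, `|v 0 j| <= c) -> `|v| <= c.
Proof.
move=> c0 vc; rewrite [leLHS]/Num.Def.normr/= mx_normrE.
by apply: bigmax_le => // -[i j] _ /=; rewrite ord1.
Qed.

Lemma derive_coord (W : normedModType R) (f : 'rV[R]_n -> W) p v :
  differentiable f p -> 'D_v f p = \sum_j v 0 j *: 'D_(stdvec R j) f p.
Proof.
move=> df; rewrite {1}(row_sum_delta v) deriveE// linear_sum/=.
by apply: eq_bigr => j _; rewrite linearZ/= deriveE.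
Qed.

(** By the mean value theorem the increment is a derivative at a point of the segment, compared with
    the one at p through the n partial derivatives; [n.+1] keeps the share of e defined when n = 0.
    Quantifying over all small radii d lets several estimates share one ball. *)
Lemma class_C1_strict_diff U (f : 'rV[R]_n -> R^o) p (e : R) :
  open U -> U p -> class_C 1 U f -> 0 < e ->
  \forall d \near 0^'+, forall x y, ball p d x -> ball p d y ->
    `|f y - f x - 'D_(y - x) f p| <= e * `|y - x|.
Proof.
move=> oU Up [df Df] e0; have n0 : 0 < e / n.+1%:R by rewrite divr_gt0// ltr0n.
have nU : nbhs p U by exact: open_nbhs_nbhs.
have nD : \forall z \near p, forall j,
    `|'D_(stdvec R j) f p - 'D_(stdvec R j) f z| <= e / n.+1%:R.
  apply: (filter_forall (F := nbhs p)) => j.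
  by move/cvgrPdist_le : (Df (stdvec R j) p Up) => /(_ _ n0).
have : \forall z \near p, U z /\ forall j,
    `|'D_(stdvec R j) f p - 'D_(stdvec R j) f z| <= e / n.+1%:R.
  by apply: filterS2 nU nD => z; split.
move=> /nbhs_ballP[r /= r0 rP]; near=> d => x y px py.
have dr : d <= r by near: d; exact: nbhs_right_le.
have dfxy (t : R) : 0 <= t <= 1 -> differentiable f (x + t *: (y - x)).
  move=> t01; apply: df; apply: (rP _ _).1; apply: (le_ball dr).
  by apply: ball_line => //; rewrite addrC subrK.
have [t t01] := segment_MVT dfxy.
rewrite [x + (y - x)]addrC subrK => ->; set c := x + _.
have [Uc Dc] : U c /\ forall j,
    `|'D_(stdvec R j) f p - 'D_(stdvec R j) f c| <= e / n.+1%:R.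
  by apply: rP; apply: (le_ball dr); apply: ball_line => //; rewrite addrC subrK.
rewrite (derive_coord _ (df _ Uc)) (derive_coord _ (df _ Up)).
rewrite -sumrB (le_trans (ler_norm_sum _ _ _))//.
apply: (@le_trans _ _ (\sum_(j < n) e / n.+1%:R * `|y - x|)).
  apply: ler_sum => j _; rewrite -scalerBr normrZ mulrC.
  by apply: ler_pM => //; [rewrite distrC|exact: rV_coord_le].
rewrite sumr_const card_ord -mulrnAl ler_wpM2r// -mulr_natr mulrAC ler_pdivrMr ?ltr0n//.
by rewrite ler_wpM2l ?ler_nat// ltW.
Unshelve. all: by end_near. Qed.

Lemma linear_coord j : linear (fun v : 'rV[R]_n => v 0 j : R^o).
Proof. by move=> a u v; rewrite !mxE. Qed.

End StrictDifferentiability.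

(** The mean value theorem is false for vector values, so each coordinate has its own intermediate
    point; the sup norm combines the bounds without loss. *)
Lemma class_C1_strict_diff_rV (R : realType) n m U (f : 'rV[R]_n -> 'rV[R]_m) p (e : R) :
  open U -> U p -> class_C 1 U f -> 0 < e ->
  \forall d \near 0^'+, forall x y, ball p d x -> ball p d y ->
    `|f y - f x - 'D_(y - x) f p| <= e * `|y - x|.
Proof.
move=> oU Up fC e0; have [df _] := fC.
have coordC (j : 'I_m) : continuous (fun v : 'rV[R]_m => v 0 j : R^o).
  by move=> v; exact: coord_continuous.
have : \forall d \near 0^'+, forall j, forall x y, ball p d x -> ball p d y ->
    `|f y 0 j - f x 0 j - 'D_(y - x) (fun z => f z 0 j : R^o) p| <= e * `|y - x|.
  apply: (filter_forall (F := 0^'+)) => j.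
  apply: (class_C1_strict_diff (f := fun z => f z 0 j : R^o) oU Up) => //.
  have := class_C_linear_comp (@linear_coord R m j) (coordC j) oU fC. exact.
apply: filterS => d fd x y px py; apply: rV_norm_le => [|j].
  by rewrite mulr_ge0// ltW.
rewrite !mxE; have := fd j x y px py.
by rewrite (derive_linear_comp (@linear_coord R m j) (coordC j))//; exact: df.
Qed.

Section InverseFunction.
Variable R : realType.

Lemma contraction_fixpoint n (A : set 'rV[R]_n) (T : 'rV[R]_n -> 'rV[R]_n) (q : R) :
  0 <= q < 1 -> closed A -> A !=set0 -> (forall x, A x -> A (T x)) ->
  (forall x y, A x -> A y -> `|T x - T y| <= q * `|x - y|) ->
  exists2 x, A x & T x = x.
Proof.
move=> /andP[q0 q1] cA A0 AT Tq.
pose X : completeNormedModType R := HB.pack 'rV[R]_n (GRing.Lmodule.on 'rV[R]_n).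
have fT : {homo T : x / A x >-> A x} by [].
have Tc : is_contraction (mkfun_fun fT).
  exists (NngNum q0); split=> //= -[x y] [/= Ax Ay]; exact: Tq.
have [x Ax xE] := @banach_fixed_point R X A (mkfun_fun fT) Tc cA A0.
by exists x.
Qed.

Lemma mulmx_lipschitz n m (M : 'M[R]_(n, m)) :
  exists2 K, 0 < K & forall v : 'rV[R]_n, `|v *m M| <= K * `|v|.
Proof.
exists (\sum_i \sum_j `|M i j| + 1) => [|v].
  by rewrite ltr_wpDl// sumr_ge0// => i _; rewrite sumr_ge0.
apply: rV_norm_le => [|j].
  by rewrite mulr_ge0// addr_ge0// sumr_ge0// => i _; rewrite sumr_ge0.
rewrite mxE (le_trans (ler_norm_sum _ _ _))// mulrDl mul1r ler_wpDr// mulr_suml.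
apply: ler_sum => i _; rewrite normrM mulrC ler_pM ?rV_coord_le//.
by rewrite (bigD1 j)//= lerDl sumr_ge0.
Qed.

(** The map T x = x - (f x - y) M, with M the inverse Jacobian at p, contracts by 1/2 near p by
    strict differentiability, and its fixed points solve f x = y. The inverse is recorded only as a
    Lipschitz bound and a surjectivity statement, which is all that [section_line_derive] asks of
    it. *)
Theorem inverse_function n U (f : 'rV[R]_n -> 'rV[R]_n) p :
  open U -> U p -> class_C 1 U f -> 'J f p \in unitmx ->
  exists r C rho : R, [/\ 0 < r, 0 < C, 0 < rho, ball p r `<=` U &
    (forall x y, ball p r x -> ball p r y -> `|y - x| <= C * `|f y - f x|) /\
    ball (f p) rho `<=` f @` ball p r].
Proof.
move=> oU Up fC Ju; have [df _] := fC; set M := invmx ('J f p).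
have [K K0 MK] := mulmx_lipschitz M.
(* Multiplication by [M] costs a factor K, so this precision gives the contraction ratio 1/2. *)
have e0 : 0 < (2 * K)^-1 by rewrite invr_gt0 mulr_gt0.
have := class_C1_strict_diff_rV oU Up fC e0.
have /nbhs_ballP[s /= s0 sU] : nbhs p U by exact: open_nbhs_nbhs.
move=> fD; near (0 : R)^'+ => r.
have fJ : forall x y, ball p r x -> ball p r y ->
    `|y - x - (f y - f x) *m M| <= 2^-1 * `|y - x|.
  move=> x y px py.
  have -> : y - x - (f y - f x) *m M = - ((f y - f x - 'D_(y - x) f p) *m M).
    by rewrite (deriveEjacobian _ (df _ Up)) [in RHS]mulmxBl mulmxK// opprB.
  rewrite normrN (le_trans (MK _))// -ler_pdivlMl// mulrA -invfM [K * 2]mulrC.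
  by move: x y px py; near: r; exact: fD.
have r0 : 0 < r by near: r; exact: nbhs_right_gt.
(* 2 K comes from |y - x| <= K |f y - f x| + |y - x| / 2. With rho = r / (4 K), T moves p by at most
   r / 4, so T maps the closed ball of radius r / 2 to itself: r / 4 + (r / 2) / 2 = r / 2. *)
exists r, (2 * K), (r / (4 * K)); split => //.
- by rewrite mulr_gt0.
- by rewrite divr_gt0// mulr_gt0.
- by apply: subset_trans sU; apply: le_ball; near: r; exact: nbhs_right_le.
split=> [x y px py|y].
  have := fJ x y px py; have := MK (f y - f x).
  have := ler_normB (y - x - (f y - f x) *m M) (- ((f y - f x) *m M)).
  rewrite opprK subrK normrN; lra.
rewrite -ball_normE/= => ye.
pose A := closed_ball_ Num.norm p (r / 2); pose T x := x - (f x - y) *m M.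
have Ar : A `<=` ball p r.
  move=> x; rewrite /A/closed_ball_/= -ball_normE/= => /le_lt_trans; apply.
  by rewrite ltr_pdivrMr// ltr_pMr// ltr1n.
have Tq x z : A x -> A z -> `|T x - T z| <= 2^-1 * `|x - z|.
  move=> /Ar px /Ar pz; have := fJ z x pz px; congr (is_true (`|_| <= _)).
  have -> : f x - f z = (f x - y) - (f z - y) by rewrite opprB addrA subrK.
  rewrite /T mulmxBl !opprB addrACA [RHS]addrACA.
  by congr (_ + _); rewrite addrC.
have pA : A p by rewrite /A /closed_ball_ /= subrr normr0 divr_ge0// ltW.
have half01 : 0 <= (2^-1 : R) < 1 by rewrite invr_ge0 ler0n invf_lt1// ltr1n.
have AT x : A x -> A (T x).
  move=> Ax; rewrite /A /closed_ball_ /= -(subrKA (T p)) [leRHS]splitr.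
  rewrite (le_trans (ler_normD _ _))// lerD//.
    rewrite /T opprB addrC subrK (le_trans (MK _))// -ler_pdivlMl//.
    rewrite (le_trans (ltW ye))// le_eqVlt; apply/orP; left; apply/eqP.
    by field; rewrite gt_eqF.
  rewrite (le_trans (Tq _ _ pA Ax))//.
  by move: Ax; rewrite /A /closed_ball_ /= => ?; rewrite [leLHS]mulrC ler_pM2r// invr_gt0.
have cA : closed A by exact: closed_closed_ball_.
have [x Ax Tx] := contraction_fixpoint half01 cA (ex_intro _ p pA) AT Tq.
exists x; first by have := Ar x Ax; rewrite -ball_normE.
apply/subr0_eq; rewrite -[LHS](mulmxKV Ju) -/M.
suff -> : (f x - y) *m M = 0 by rewrite mul0mx.
by apply/eqP; rewrite -oppr_eq0 -(inj_eq (addrI x)) addr0; apply/eqP.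
Unshelve. all: by end_near. Qed.

End InverseFunction.

(** * Primitives and extension of germs *)

Section Antiderivative.
Variable R : realType.
Implicit Types (f g h k : R -> R) (a b s t : R).

Lemma is_derive0_itv_cst f a b :
  (forall t, a < t < b -> is_derive t 1 f 0) ->
  forall s t, a < s < b -> a < t < b -> f s = f t.
Proof.
move=> df; suff lt_cst s t : s < t -> a < s < b -> a < t < b -> f s = f t.
  move=> s t sab tab; have [st|ts|->//] := ltgtP s t.
    exact: (lt_cst _ _ st sab tab).
  by rewrite (lt_cst _ _ ts tab sab).
move=> st /andP[as_ sb] /andP[at_ tb].
have df_st x : x \in `[s, t] -> is_derive x 1 f 0.
  rewrite in_itv/= => /andP[sx xt]; apply: df.
  by rewrite (lt_le_trans as_)//= (le_lt_trans xt).
have df_oo x : x \in `]s, t[ -> is_derive x 1 f 0.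
  by move=> sxt; apply: df_st; rewrite in_itv/= !ltW// (itvP sxt).
have f_cont : {within `[s, t], continuous f}.
  by apply: derivable_within_continuous => x /df_st[].
have [x _] := MVT st df_oo f_cont.
by rewrite mul0r => /subr0_eq ->.
Qed.

Lemma antiderivative_ray k a : continuous k ->
  exists G, forall t, a < t -> is_derive t 1 G (k t).
Proof.
move=> kc; exists (fun x => \int[lebesgue_measure]_(t in `[a, x]) k t)%R => t at_.
have tt1 : t < t + 1 by rewrite ltrDl.
have ki : lebesgue_measure.-integrable `[a, (t + 1)] (EFin \o k).
  apply: continuous_compact_integrable; first exact: segment_compact.
  exact: continuous_subspaceT.
have [d <-] := continuous_FTC1_closed tt1 ki at_ (kc t).
by rewrite derive1E; exact: derivableP.
Qed.

(** An integral from a fixed endpoint is a primitive only to the right of it. The left half is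
    obtained by the reflection t -> - t, and the two halves are glued on ]-1, 1[, where they differ
    by the constant [c]. *)
Lemma antiderivative k : continuous k ->
  exists G, forall t, is_derive t 1 G (k t).
Proof.
move=> kc; have [G1 dG1] := antiderivative_ray (-1) kc.
have [G dG] : exists G, forall t, -1 < t -> is_derive t 1 G (k (- t)).
  apply: (antiderivative_ray (k := k \o -%R)) => t.
  by apply: continuous_comp; [exact: opp_continuous|exact: kc].
pose G2 t : R := - G (- t).
have dG2 t : t < 1 -> is_derive t 1 G2 (k t).
  move=> t1; have dGt : is_derive (- t) 1 G (k t).
    by rewrite -[X in k X]opprK; apply: dG; rewrite ltrN2.
  have -> : k t = - (- k t) by rewrite opprK.
  apply: is_deriveN.
  have := @is_derive1_comp _ G -%R t (k t) (-1) dGt _.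
  by rewrite mulrN1; apply; exact: is_deriveNid.
pose c := G1 0 - G2 0.
have dG12 t : -1 < t < 1 -> is_derive t 1 (G1 - G2) 0.
  move=> /andP[t1 t2]; rewrite -(subrr (k t)).
  by apply: is_deriveB; [exact: dG1|exact: dG2].
have G12 t : -1 < t < 1 -> G2 t + c = G1 t.
  move=> t1; rewrite /c; have := is_derive0_itv_cst dG12 t1.
  move=> /(_ 0); rewrite ltrN10 ltr01 => /(_ isT).
  rewrite -![(_ - _ : _ -> _) _]/(_ - _) => <-.
  by rewrite addrC subrK.
exists (fun t => if t < 0 then G2 t + c else G1 t) => t.
have [t0|t0] := ltP t 0.
  apply: (near_eq_is_derive (f := G2 + cst c)).
    near=> x; rewrite ifT//; near: x; exact: lt_nbhsl.
  have -> : k t = k t + 0 by rewrite addr0.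
  by apply: is_deriveD; apply: dG2; rewrite (lt_trans t0).
have t1 : -1 < t by rewrite (lt_le_trans _ t0)// ltrN10.
apply: (near_eq_is_derive (f := G1)); last exact: dG1.
near=> x; case: ifPn => // x0; rewrite G12//.
rewrite (lt_trans x0)// andbT; near: x; exact: lt_nbhsr.
Unshelve. all: by end_near. Qed.

(** [class_C] ranges over all directions v, which are scalars on the line: ['D_v] is v times the
    ordinary derivative. *)
Lemma class_C1_of_derive f g k : (forall t, f t = g t) ->
  (forall t, is_derive t 1 g (k t)) -> continuous k ->
  class_C 1 setT (f : R^o -> R^o).
Proof.
move=> /funext -> dg kc.
have gd t : differentiable g t by apply/derivable1_diffP; have [] := dg t.
split=> [t _|v t _]; first exact: gd.
rewrite (_ : 'D_v _ = v *: k); first by apply: continuousZl_tmp; exact: kc.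
apply/funext => s; rewrite -[RHS]/(v *: k s); have [_ <-] := dg s.
by rewrite -[X in derive _ _ X]mulr1 deriveZv.
Qed.

Lemma class_C2_of_derive f h k :
  (forall t, is_derive t 1 f (h t)) -> (forall t, is_derive t 1 h (k t)) ->
  continuous k -> class_C 2 setT (f : R^o -> R^o).
Proof.
move=> df dh kc.
have fd t : differentiable f t by apply/derivable1_diffP; have [] := df t.
split=> [t _|v]; first exact: fd.
apply: (@class_C1_of_derive _ (v *: h) (v *: k)).
- by move=> t; rewrite -[X in derive _ _ X]mulr1 deriveZv//; have [_ ->] := df t.
- by move=> t; apply: continuousZl_tmp; exact: kc.
Qed.

(** Composing k with the clamp onto [t0 - r, t0 + r] makes it continuous on the whole line, and two
    primitives of the result give f. The margin up to 2 r makes k continuous at the ends of the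
    clamped interval as well. *)
Lemma C1_germ_primitive h k (t0 r : R) : 0 < r ->
  (forall t, `|t - t0| < 2 * r -> is_derive t 1 h (k t)) ->
  (forall t, `|t - t0| < 2 * r -> {for t, continuous k}) ->
  exists f, [/\ class_C 2 setT (f : R^o -> R^o), nonconstant f
    & forall t, `|t - t0| < r -> is_derive t 1 f (h t)].
Proof.
move=> r0 dh kc.
pose clamp t := Num.max (t0 - r) (Num.min t (t0 + r)).
have clampc : continuous clamp.
  move=> t; apply: (@continuous_max _ _ (cst (t0 - r)) (id \min cst (t0 + r))).
    exact: cvg_cst.
  by apply: (@continuous_min _ _ id (cst (t0 + r))); [exact: cvg_id|exact: cvg_cst].
have clampP t : `|clamp t - t0| < 2 * r.
  rewrite /clamp; rewrite ltr_norml; apply/andP; split.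
    rewrite ltrBrDl lt_max; apply/orP; left; lra.
  by rewrite ltrBlDr gt_max gt_min; apply/andP; split; [lra|apply/orP; right; lra].
have clampE t : `|t - t0| < r -> clamp t = t.
  rewrite ltr_norml => /andP[t1 t2]; rewrite /clamp min_l; last lra.
  by rewrite max_r//; lra.
(* The second summand, supported away from the germ, is there to make [f]
   nonconstant. *)
pose K t := k (clamp t) + Num.max 0 (t - (t0 + r)).
have Kc : continuous K.
  move=> t; apply: (@continuousD R R^o _ (k \o clamp) (cst 0 \max (id - cst (t0 + r)))).
    by apply: continuous_comp; [exact: clampc|exact: kc].
  apply: (@continuous_max _ _ (cst 0) (id - cst (t0 + r))); first exact: cvg_cst.
  by apply: continuousB; [exact: cvg_id|exact: cvg_cst].
have [H dH] := antiderivative Kc.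
(* The constant is chosen so that [H'] and [h], which have the same derivative near t0, agree at
   t0. *)
pose H' t := H t + (h t0 - H t0).
have dH' t : is_derive t 1 H' (K t).
  by rewrite -[K t]addr0; apply: is_deriveD.
have H'c : continuous H'.
  by move=> t; apply/differentiable_continuous/derivable1_diffP; have [] := dH' t.
have [f df] := antiderivative H'c.
exists f; split.
- exact: class_C2_of_derive df dH' Kc.
(* If f were constant, [K] would vanish; but from t0 + r to t0 + r + 1 the clamped term stays the
   same while the added term grows from 0 to 1. *)
- apply: contrapT => fcst.
  have fE : f = cst (f 0).
    by apply/funext => t; apply: contrapT => ?; apply: fcst; exists t, 0.
  have H'E : H' = cst 0.
    by apply/funext => t; have [_ <-] := df t; rewrite fE derive_cst.
  have K0 t : K t = 0 by have [_ <-] := dH' t; rewrite H'E derive_cst.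
  have := K0 (t0 + r); have := K0 (t0 + r + 1); rewrite /K.
  have -> : clamp (t0 + r + 1) = clamp (t0 + r).
    by rewrite /clamp minxx (min_r (x := t0 + r + 1))// lerDl.
  rewrite subrr maxxx addrAC subrr add0r max_r// addr0 => + k0.
  by rewrite k0 add0r => /eqP; rewrite oner_eq0.
move=> t tr; suff <- : H' t = h t by [].
have dHh s : t0 - r < s < t0 + r -> is_derive s 1 (H' - h) 0.
  move=> sr; have sr' : `|s - t0| < r by rewrite ltr_norml; lra.
  rewrite -(subrr (k s)); apply: is_deriveB; last by apply: dh; lra.
  suff <- : K s = k s by [].
  by rewrite /K clampE// max_l ?addr0//; lra.
have t0r : t0 - r < t0 < t0 + r by lra.
have tr' : t0 - r < t < t0 + r by move: tr; rewrite ltr_norml; lra.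
have := is_derive0_itv_cst dHh t0r tr'.
rewrite -![(_ - _ : _ -> _) _]/(_ - _) /H' addrCA subrr addr0 subrr.
by move/esym/subr0_eq.
Qed.

End Antiderivative.

(** * The metric of the tangent bundle of the plane *)

Section Ambient.
Variable R : realType.
Implicit Types (X Y Z A B : 'rV[R]_(2 + 2)) (v w : 'rV[R]_2).

Lemma sum2 (f : 'I_2 -> R) : \sum_i f i = f 0 + f 1.
Proof. by rewrite big_ord_recl big_ord1; congr (_ + f _); exact: val_inj. Qed.

Lemma innerE v w : inner v w = v 0 0 * w 0 0 + v 0 1 * w 0 1.
Proof. by rewrite /inner sum2. Qed.

Lemma OmegaE X Y : Omega X Y =
  fibrepart X 0 0 * basepart Y 0 0 + fibrepart X 0 1 * basepart Y 0 1
  - (basepart X 0 0 * fibrepart Y 0 0 + basepart X 0 1 * fibrepart Y 0 1).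
Proof. by rewrite /Omega !innerE. Qed.

Lemma GGE q X Y : GG q X Y =
  fibrepart X 0 0 * basepart Y 0 1 - fibrepart X 0 1 * basepart Y 0 0
  - (basepart X 0 0 * fibrepart Y 0 1 - basepart X 0 1 * fibrepart Y 0 0).
Proof.
rewrite /GG OmegaE /JJ /basepart /fibrepart row_mxKl row_mxKr /jrot !mxE/=; ring.
Qed.

Lemma basepartD X Y : basepart (X + Y) = basepart X + basepart Y.
Proof. exact: raddfD. Qed.

Lemma fibrepartD X Y : fibrepart (X + Y) = fibrepart X + fibrepart Y.
Proof. exact: raddfD. Qed.

Lemma basepartZ a X : basepart (a *: X) = a *: basepart X.
Proof. exact: linearZ. Qed.

Lemma fibrepartZ a X : fibrepart (a *: X) = a *: fibrepart X.
Proof. exact: linearZ. Qed.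

Lemma OmegaDl X Y Z : Omega (X + Y) Z = Omega X Z + Omega Y Z.
Proof. by rewrite !OmegaE !basepartD !fibrepartD !mxE; ring. Qed.

Lemma OmegaZl a X Z : Omega (a *: X) Z = a * Omega X Z.
Proof. by rewrite !OmegaE !basepartZ !fibrepartZ !mxE; ring. Qed.

Lemma Omega_suml n (F : 'I_n -> 'rV[R]_(2 + 2)) Z :
  Omega (\sum_i F i) Z = \sum_i Omega (F i) Z.
Proof.
apply: (big_morph (fun X => Omega X Z)) => [X Y|]; first exact: OmegaDl.
by rewrite -(scale0r 0) OmegaZl mul0r.
Qed.

Lemma OmegaC X Y : Omega Y X = - Omega X Y.
Proof. by rewrite !OmegaE; ring. Qed.

(* [thetar X Y + i thetai X Y] is the value of [dz1 /\ dz2] on [(X, Y)], for the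
   complex coordinates [z1 = x1 + i x2] and [z2 = y1 + i y2]. *)
Definition thetar X Y : R :=
  basepart X 0 0 * fibrepart Y 0 0 - basepart Y 0 0 * fibrepart X 0 0
  - (basepart X 0 1 * fibrepart Y 0 1 - basepart Y 0 1 * fibrepart X 0 1).

Definition thetai X Y : R :=
  basepart X 0 0 * fibrepart Y 0 1 - basepart Y 0 0 * fibrepart X 0 1
  + (basepart X 0 1 * fibrepart Y 0 0 - basepart Y 0 1 * fibrepart X 0 0).

(** [GG] and [Omega] are, up to sign, the real and imaginary parts of a Hermitian form on C^2 of
    determinant -1, so the Hermitian Gram determinant of (X, Y) is - |theta|^2. *)
Lemma gram_theta q X Y : GG q X X * GG q Y Y - GG q X Y ^+ 2 =
  Omega X Y ^+ 2 - (thetar X Y ^+ 2 + thetai X Y ^+ 2).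
Proof. by rewrite !GGE OmegaE /thetar /thetai; ring. Qed.

(* [A] and [B] are the derivatives of [X] and [Y] in some direction, so that the
   left-hand side is [Im (conj theta . d theta)]. *)
Lemma theta_derivation q X Y A B :
  thetar X Y * (thetai A Y + thetai X B) - thetai X Y * (thetar A Y + thetar X B) =
  - (GG q Y Y * Omega A X - GG q X Y * Omega A Y - GG q X Y * Omega B X
     + GG q X X * Omega B Y)
  - Omega X Y * (GG q A Y - GG q B X).
Proof. by rewrite !GGE !OmegaE /thetar /thetai; ring. Qed.

Lemma GG_sym q X Y : GG q X Y = GG q Y X.
Proof. by rewrite !GGE; ring. Qed.

Lemma derive_metric_mx i j q Z :
  'D_Z (fun q' => metric_mx (@GG R) q' i j : R^o) q = 0.
Proof.
by rewrite (_ : (fun _ => _) = cst (metric_mx (@GG R) 0 i j)) ?derive_cst.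
Qed.

Lemma christoffel_GG i j k : christoffel (@GG R) i j k = cst 0.
Proof.
apply/funext => q; rewrite /christoffel big1 ?mulr0// => l _.
by rewrite !derive_metric_mx !addr0 subr0 mulr0.
Qed.

Lemma flat_GG : flat (@GG R).
Proof.
move=> l k i j q; rewrite /curvature !christoffel_GG !derive_cst subrr add0r.
by rewrite big1// => m _; rewrite !christoffel_GG !mulr0 subrr.
Qed.

Lemma levi_civita_GG q X Y : levi_civita_term (@GG R) q X Y = 0.
Proof.
apply/rowP => k; rewrite !mxE big1// => i _; rewrite big1// => j _.
by rewrite christoffel_GG !mul0r.
Qed.

Lemma class_C_cst (V W : normedModType R) k (U : set V) (c : W) : class_C k U (cst c).
Proof.
elim: k c => [|k IH] c /=; first by move=> x _; exact: cvg_cst.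
split=> [x _|v]; first exact: differentiable_cst.
by rewrite (_ : 'D_v _ = cst 0) //; apply/funext => x; rewrite derive_cst.
Qed.

Lemma basepart_lshift j : basepart (stdvec R (lshift 2 j)) = delta_mx 0 j.
Proof. by apply/rowP => k; rewrite !mxE eq_lshift. Qed.

Lemma basepart_rshift j : basepart (stdvec R (rshift 2 j)) = 0.
Proof. by apply/rowP => k; rewrite !mxE eq_lrshift andbF. Qed.

Lemma fibrepart_lshift j : fibrepart (stdvec R (lshift 2 j)) = 0.
Proof. by apply/rowP => k; rewrite !mxE eq_rlshift andbF. Qed.

Lemma fibrepart_rshift j : fibrepart (stdvec R (rshift 2 j)) = delta_mx 0 j.
Proof. by apply/rowP => k; rewrite !mxE eq_rshift. Qed.

Definition jmx : 'M[R]_2 := delta_mx 1 0 - delta_mx 0 1.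

Lemma ord2P (i : 'I_2) : i = 0 \/ i = 1.
Proof. by case: i => -[|[|//]] ?; [left|right]; exact: val_inj. Qed.

Lemma jmx2 : jmx *m jmx = - 1%:M.
Proof.
apply/matrixP => i j; rewrite !mxE sum2 !mxE.
by have [->|->] := ord2P i; have [->|->] := ord2P j; rewrite /=; ring.
Qed.

Lemma tr_jmx : jmx^T = - jmx.
Proof. by rewrite /jmx linearB/= !trmx_delta opprB. Qed.

Lemma metric_mx_GG q : metric_mx (@GG R) q = block_mx 0 jmx (- jmx) 0.
Proof.
apply/matrixP => i j; rewrite mxE GGE.
case: (split_ordP i) => i' ->; case: (split_ordP j) => j' ->;
  rewrite ?basepart_lshift ?basepart_rshift ?fibrepart_lshift ?fibrepart_rshift.
- by rewrite block_mxEul !mxE; ring.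
- rewrite block_mxEur !mxE.
  by have [->|->] := ord2P i'; have [->|->] := ord2P j'; rewrite /=; ring.
- rewrite block_mxEdl !mxE.
  by have [->|->] := ord2P i'; have [->|->] := ord2P j'; rewrite /=; ring.
- by rewrite block_mxEdr !mxE; ring.
Qed.

Lemma pseudo_metric_GG : pseudo_metric (@GG R).
Proof.
split=> [q X a Y Z|q X Y|q|k X Y].
- by rewrite !GGE !basepartD !fibrepartD !basepartZ !fibrepartZ !mxE/=; ring.
- exact: GG_sym.
- have: metric_mx (@GG R) q *m metric_mx (@GG R) q = 1%:M.
    rewrite metric_mx_GG mulmx_block !mul0mx !mulmx0 !addr0 !add0r.
    by rewrite mulNmx mulmxN jmx2 opprK -scalar_mx_block.
  by case/mulmx1_unit.
- exact: class_C_cst.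
Qed.

Lemma signature_GG q : @has_signature R 2 2 (metric_mx (@GG R) q).
Proof.
(* Base and fibre planes are both isotropic, so the metric is a sum of hyperbolic planes: a base
   vector plus or minus half of its dual fibre vector has square 1 or -1. *)
pose N : 'M[R]_2 := 2^-1 *: jmx; pose B : 'M[R]_(2 + 2) := block_mx 1%:M N 1%:M (- N).
have BMB : B *m metric_mx (@GG R) q *m B^T = block_mx 1%:M 0 0 (- 1%:M).
  have NT : N^T = - N by rewrite /N linearZ/= tr_jmx scalerN.
  have jN : jmx *m N = - (2^-1)%:M.
    by rewrite -scalemxAr jmx2 scalerN scale_scalar_mx mulr1.
  have Nj : N *m jmx = - (2^-1)%:M.
    by rewrite -scalemxAl jmx2 scalerN scale_scalar_mx mulr1.
  have half2 : (2^-1)%:M + (2^-1)%:M = 1%:M :> 'M[R]_2.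
    by rewrite -raddfD/=; congr (_%:M); field.
  rewrite metric_mx_GG tr_block_mx !trmx1 linearN/= NT opprK !mulmx_block.
  rewrite !mulmx0 !mul1mx !mulmx1 !add0r !addr0 !mulmxN !mulNmx Nj jN !opprK.
  by rewrite half2 -opprD half2 addNr subrr.
exists B => //.
have : B *m metric_mx (@GG R) q *m B^T \in unitmx.
  have : block_mx 1%:M 0 0 (- 1%:M) *m block_mx 1%:M 0 0 (- 1%:M) = 1%:M :> 'M[R]_(2 + 2).
    rewrite mulmx_block !mulmx0 !mul0mx mul1mx mulmxN mulmx1 opprK !addr0 add0r.
    by rewrite -scalar_mx_block.
  by rewrite BMB; case/mulmx1_unit.
by rewrite !unitmx_mul => /andP[/andP[]].
Qed.

(** Cramer's rule with the determinant multiplied out, so that identities involving [invmx] become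
    polynomial. *)
Lemma mul_det2_invmx (A : 'M[R]_2) : A \in unitmx ->
  let d := A 0 0 * A 1 1 - A 0 1 * A 1 0 in
  [/\ d != 0, d * invmx A 0 0 = A 1 1, d * invmx A 1 1 = A 0 0,
    d * invmx A 0 1 = - A 0 1 & d * invmx A 1 0 = - A 1 0].
Proof.
move=> Au; set N := invmx A.
have eN i j : A i 0 * N 0 j + A i 1 * N 1 j = (i == j)%:R.
  rewrite -(sum2 (fun k => A i k * N k j)).
  by have /matrixP/(_ i j) := mulmxV Au; rewrite !mxE.
have e00 : A 0 0 * N 0 0 + A 0 1 * N 1 0 = 1 := eN 0 0.
have e01 : A 0 0 * N 0 1 + A 0 1 * N 1 1 = 0 := eN 0 1.
have e10 : A 1 0 * N 0 0 + A 1 1 * N 1 0 = 0 := eN 1 0.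
have e11 : A 1 0 * N 0 1 + A 1 1 * N 1 1 = 1 := eN 1 1.
move: (A 0 0) (A 0 1) (A 1 0) (A 1 1) (N 0 0) (N 0 1) (N 1 0) (N 1 1) e00 e01 e10 e11.
move=> a b c d n m k l e00 e01 e10 e11 /=.
have En : (a * d - b * c) * n = d.
  have -> : (a * d - b * c) * n = d * (a * n + b * k) - b * (c * n + d * k) by ring.
  by rewrite e00 e10; ring.
have El : (a * d - b * c) * l = a.
  have -> : (a * d - b * c) * l = a * (c * m + d * l) - c * (a * m + b * l) by ring.
  by rewrite e11 e01; ring.
have Em : (a * d - b * c) * m = - b.
  have -> : (a * d - b * c) * m = d * (a * m + b * l) - b * (c * m + d * l) by ring.
  by rewrite e11 e01; ring.
have Ek : (a * d - b * c) * k = - c.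
  have -> : (a * d - b * c) * k = a * (c * n + d * k) - c * (a * n + b * k) by ring.
  by rewrite e00 e10; ring.
split=> //; apply/eqP => D0.
have a0 : a = 0 by rewrite -El D0 mul0r.
have b0 : b = 0 by apply/eqP; rewrite -oppr_eq0 -Em D0 mul0r.
by move: e00; rewrite a0 b0 !mul0r addr0 => /esym/eqP; rewrite oner_eq0.
Qed.

(** Pairing H with a tangent vector under [Omega] removes the tangential part of each second
    derivative, since L is Lagrangian; the Christoffel symbols vanish. What remains is the trace of
    S, multiplied by the Gram determinant to clear the inverse matrix. *)
Lemma minimal_Omega (F : 'rV[R]_2 -> 'rV[R]_(2 + 2)) p :
  let X i := partial F i p in
  let S i j k := Omega ('D_(stdvec R i) (partial F j) p) (X k) in
  let g i j := GG (F p) (X i) (X j) in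
  induced_mx (@GG R) F p \in unitmx -> (forall i j, Omega (X i) (X j) = 0) ->
  mean_curvature (@GG R) F p = 0 ->
  forall k, g 1 1 * S 0 0 k - g 0 1 * (S 0 1 k + S 1 0 k) + g 0 0 * S 1 1 k = 0.
Proof.
move=> X S g gu lagr H0 k; pose N := invmx (induced_mx (@GG R) F p).
have NS : \sum_i \sum_j N i j * S i j k = 0.
  transitivity
    (Omega (\sum_(i < 2) \sum_(j < 2) N i j *: second_ff (@GG R) F i j p) (X k)).
    rewrite Omega_suml; apply: eq_bigr => i _; rewrite Omega_suml; apply: eq_bigr => j _.
    rewrite OmegaZl /second_ff /cov_partial levi_civita_GG addr0.
    rewrite -scaleN1r OmegaDl OmegaZl [X in _ + _ * X](_ : _ = 0) ?mulr0 ?addr0//.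
    rewrite Omega_suml big1// => i' _; rewrite Omega_suml big1// => j' _.
    by rewrite OmegaZl lagr mulr0.
  rewrite (_ : \sum_(i < 2) _ = 0); first by rewrite -(scale0r 0) OmegaZl mul0r.
  apply/eqP; move/eqP: H0; rewrite scaler_eq0 => /orP[|//].
  by rewrite invr_eq0 pnatr_eq0.
have [_ E00 E11 E01 E10] := mul_det2_invmx gu.
have ME i j : induced_mx (@GG R) F p i j = g i j by rewrite mxE.
rewrite !ME -/N in E00 E11 E01 E10.
have g10 : g 1 0 = g 0 1 by exact: GG_sym.
clear ME H0; clearbody S g N.
move: (g 0 0) (g 0 1) (g 1 0) (g 1 1) g10 E00 E11 E01 E10 => a b c d ->.
move: NS; rewrite !sum2; move: (N 0 0) (N 0 1) (N 1 0) (N 1 1) => n m l q.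
move: (S 0 0 k) (S 0 1 k) (S 1 0 k) (S 1 1 k) => s00 s01 s10 s11 NS E00 E11 E01 E10.
transitivity ((a * d - b * b) * (n * s00 + m * s01 + (l * s10 + q * s11))).
  by rewrite !mulrDr !mulrA E00 E11 E01 E10; ring.
by rewrite NS mulr0.
Qed.

End Ambient.

(** * The argument of theta is constant *)

Section Leibniz.
Variables (R : realType) (V W : normedModType R).

(** The product rule itself is the property, rather than bilinearity: it is closed under sums and
    differences and holds for products of two functionals, from which all the forms below are
    built. *)
Definition leibniz (b : W -> W -> R) := forall (G H : V -> W) p,
  differentiable G p -> differentiable H p ->
  differentiable (fun q => b (G q) (H q) : R^o) p /\
  forall v, 'D_v (fun q => b (G q) (H q) : R^o) p =
    b ('D_v G p) (H p) + b (G p) ('D_v H p).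

Definition functional (l : W -> R) := linear (l : W -> R^o) /\ continuous (l : W -> R^o).

Lemma leibnizM l1 l2 : functional l1 -> functional l2 ->
  leibniz (fun X Y => l1 X * l2 Y).
Proof.
move=> [l1l l1c] [l2l l2c] G H p dG dH.
have d1 := differentiable_linear_comp l1l l1c dG.
have d2 := differentiable_linear_comp l2l l2c dH.
split=> [|v]; first exact: differentiableM d1 d2.
rewrite (deriveM (diff_derivable d1) (diff_derivable d2)).
rewrite (derive_linear_comp l1l l1c)// (derive_linear_comp l2l l2c)//.
by rewrite addrC /=; congr (_ + _); exact: mulrC.
Qed.

Lemma leibnizMC l1 l2 : functional l1 -> functional l2 ->
  leibniz (fun X Y => l1 Y * l2 X).
Proof.
move=> f1 f2 G H p dG dH; have [d D] := leibnizM f1 f2 dH dG.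
by split=> // v; rewrite D addrC.
Qed.

Lemma leibnizD b1 b2 : leibniz b1 -> leibniz b2 -> leibniz (fun X Y => b1 X Y + b2 X Y).
Proof.
move=> l1 l2 G H p dG dH; have [d1 D1] := l1 G H p dG dH; have [d2 D2] := l2 G H p dG dH.
split=> [|v]; first exact: differentiableD d1 d2.
by rewrite (deriveD (diff_derivable d1) (diff_derivable d2)) D1 D2 addrACA.
Qed.

Lemma leibnizB b1 b2 : leibniz b1 -> leibniz b2 -> leibniz (fun X Y => b1 X Y - b2 X Y).
Proof.
move=> l1 l2 G H p dG dH; have [d1 D1] := l1 G H p dG dH; have [d2 D2] := l2 G H p dG dH.
split=> [|v]; first exact: differentiableB d1 d2.
by rewrite (deriveB (diff_derivable d1) (diff_derivable d2)) D1 D2 opprD addrACA.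
Qed.

End Leibniz.

Section Forms.
Variables (R : realType) (V : normedModType R).

Lemma functional_basepart j : functional (fun X : 'rV[R]_(2 + 2) => basepart X 0 j).
Proof.
split=> [a X Y|X]; first by rewrite basepartD basepartZ !mxE.
apply: (@continuous_comp _ _ _ (@basepart R) (fun v => v 0 j : R^o)).
  exact: continuous_lsubmx.
exact: coord_continuous.
Qed.

Lemma functional_fibrepart j : functional (fun X : 'rV[R]_(2 + 2) => fibrepart X 0 j).
Proof.
split=> [a X Y|X]; first by rewrite fibrepartD fibrepartZ !mxE.
apply: (@continuous_comp _ _ _ (@fibrepart R) (fun v => v 0 j : R^o)).
  exact: continuous_rsubmx.
exact: coord_continuous.
Qed.

Local Hint Resolve functional_basepart functional_fibrepart : core.

Lemma leibniz_Omega : @leibniz R V _ (@Omega R).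
Proof.
rewrite (_ : @Omega R = fun X Y => 
  fibrepart X 0 0 * basepart Y 0 0 + fibrepart X 0 1 * basepart Y 0 1
  - (basepart X 0 0 * fibrepart Y 0 0 + basepart X 0 1 * fibrepart Y 0 1)).
  by apply: leibnizB; apply: leibnizD; exact: leibnizM.
by apply/funext => X; apply/funext => Y; exact: OmegaE.
Qed.

Lemma leibniz_thetar : @leibniz R V _ (@thetar R).
Proof.
by apply: leibnizB; apply: leibnizB;
  [exact: leibnizM|exact: leibnizMC|exact: leibnizM|exact: leibnizMC].
Qed.

Lemma leibniz_thetai : @leibniz R V _ (@thetai R).
Proof.
by apply: leibnizD; apply: leibnizB;
  [exact: leibnizM|exact: leibnizMC|exact: leibnizM|exact: leibnizMC].
Qed.

End Forms.

Lemma class_C2_derive_comm_rV (R : realType) (V : normedModType R) n (U : set V)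
    (F : V -> 'rV[R]_n) p v w : open U -> U p -> class_C 2 U F ->
  'D_w ('D_v F) p = 'D_v ('D_w F) p.
Proof.
move=> oU Up FC; have [dF DF] := FC; apply/rowP => k.
have kc : continuous (fun v : 'rV[R]_n => v 0 k : R^o).
  by move=> ?; exact: coord_continuous.
have kl := @linear_coord R n k.
have comp u u' : ('D_u' ('D_u F) p) 0 k = 'D_u' ('D_u (fun q => F q 0 k : R^o)) p.
  rewrite -(derive_linear_comp kl kc); last by have [+ _] := DF u; exact.
  apply: near_eq_derive; apply: open_near_eq oU _ Up => q Uq.
  by rewrite /= -(derive_linear_comp kl kc)//; exact: dF.
have FkC : class_C 2 U (fun q => F q 0 k : R^o) := class_C_linear_comp kl kc oU FC.
exact: etrans (comp v w) (etrans (class_C2_derive_comm v w oU Up FkC) (esym (comp w v))).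
Qed.

Section Wronskian.
Variable R : realType.

(** The quotient m / n below is, up to sign, the tangent of the angle between (a, b) at time t and
    at time 0. Its derivative is a multiple of the Wronskian, and it starts at 0; the last
    hypothesis keeps n away from 0. *)
Lemma wronskian0_parallel (a b a' b' : R -> R) :
  (forall t : R, 0 <= t <= 1 -> is_derive t 1 a (a' t)) ->
  (forall t : R, 0 <= t <= 1 -> is_derive t 1 b (b' t)) ->
  (forall t : R, 0 <= t <= 1 -> a t * b' t - b t * a' t = 0) ->
  (forall t : R, 0 <= t <= 1 -> a t * a 0 + b t * b 0 != 0) ->
  a 1 * b 0 = b 1 * a 0.
Proof.
move=> da db w0 n0.
pose m : R -> R := b 0 *: a - a 0 *: b; pose n : R -> R := a 0 *: a + b 0 *: b.
have nE t : n t = a t * a 0 + b t * b 0.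
  by rewrite /n -![(_ + _ : _ -> _) _]/(_ + _); congr (_ + _); exact: mulrC.
have dm (t : R) : 0 <= t <= 1 -> is_derive t 1 m (b 0 * a' t - a 0 * b' t).
  by move=> t01; have := da t t01; have := db t t01; move=> ? ?; exact: is_deriveB.
have dn (t : R) : 0 <= t <= 1 -> is_derive t 1 n (a 0 * a' t + b 0 * b' t).
  by move=> t01; have := da t t01; have := db t t01; move=> ? ?; exact: is_deriveD.
have dq (t : R) : 0 <= t <= 1 -> is_derive t 1 (m * (fun t => (n t)^-1)) 0.
  move=> t01; have nt : n t != 0 by rewrite nE n0.
  have dmt := dm t t01; have dnt := dn t t01.
  have dnV : is_derive t 1 (fun t => (n t)^-1)
      (- (n t) ^- 2 *: (a 0 * a' t + b 0 * b' t)).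
    apply: DeriveDef; first by apply: derivableV => //; have [] := dnt.
    by rewrite deriveV//; have [? ->] := dnt.
  have := is_deriveM dmt dnV; rewrite (_ : _ + _ = 0)//.
  rewrite -[_ *: _ in X in X + _]/(m t * (- (n t) ^- 2 * (a 0 * a' t + b 0 * b' t))).
  rewrite -[_ *: _ in X in _ + X]/((n t)^-1 * (b 0 * a' t - a 0 * b' t)).
  transitivity (- (n t) ^- 2 * (a 0 ^+ 2 + b 0 ^+ 2) * (a t * b' t - b t * a' t)).
    have -> : m t = b 0 * a t - a 0 * b t by [].
    have nE' := nE t; rewrite nE' in nt *; field.
    by [].
  by rewrite w0// mulr0.
have qc : {within `[0, 1], continuous (m * (fun t => (n t)^-1))}.
  by apply: derivable_within_continuous => t; rewrite in_itv/= => /dq[].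
have dq' (t : R) : t \in `]0, 1[ -> is_derive t 1 (m * (fun t => (n t)^-1)) 0.
  by rewrite in_itv/= => /andP[t0 t1]; apply: dq; rewrite !ltW.
have [t _] := MVT ltr01 dq' qc.
rewrite mul0r => /subr0_eq.
rewrite -![(m * _) _]/(m _ * (n _)^-1).
have -> : m 0 = 0 by rewrite -[LHS]/(b 0 * a 0 - a 0 * b 0) mulrC subrr.
rewrite mul0r => /eqP; rewrite mulf_eq0 invr_eq0 nE (negbTE (n0 _ _)) ?lexx ?ler01// orbF.
by rewrite -[m 1]/(b 0 * a 1 - a 0 * b 1) subr_eq0 => /eqP e; rewrite mulrC e mulrC.
Qed.
End Wronskian.

Section Frame.
Variable R : realType.

(* [V] is chosen such that [(V 0 0 + i V 0 1) ^+ 2] is a positive multiple of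
   [n - i m]; it is the square root obtained by adding the modulus. *)
Lemma exists_frame (m n : R) : exists V : 'rV[R]_2,
  inner V V = 1 /\ m * (V 0 0 ^+ 2 - V 0 1 ^+ 2) + n * (2 * V 0 0 * V 0 1) = 0.
Proof.
pose mkV (a b : R) : 'rV[R]_2 := \row_i if i == 0 then a else b.
have mkV0 a b : mkV a b 0 0 = a by rewrite mxE.
have mkV1 a b : mkV a b 0 1 = b by rewrite mxE.
pose rho := Num.sqrt (n ^+ 2 + m ^+ 2).
have rho2 : rho ^+ 2 = n ^+ 2 + m ^+ 2 by rewrite sqr_sqrtr// addr_ge0// sqr_ge0.
(* Here n = - rho, hence m = 0, and the general formula would divide by zero; a coordinate axis does
   the job. *)
have [rn0|rn0] := eqVneq (rho + n) 0.
  exists (mkV 1 0); rewrite innerE mkV0 mkV1; split; first by ring.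
  have : m ^+ 2 = 0.
    by rewrite -[m ^+ 2](addKr (n ^+ 2)) -rho2 -(addr0_eq rn0) sqrrN addNr.
  by move/eqP; rewrite expf_eq0/= => /eqP ->; ring.
pose w := (rho + n) ^+ 2 + m ^+ 2.
have w0 : 0 < w by rewrite ltr_pwDl ?sqr_ge0// exprn_even_gt0.
pose s := Num.sqrt w; have s2 : s ^+ 2 = w by rewrite sqr_sqrtr// ltW.
have s0 : s != 0 by rewrite sqrtr_eq0 -ltNge.
exists (mkV ((rho + n) / s) (- m / s)); rewrite innerE !mkV0 !mkV1; split.
  transitivity (w / s ^+ 2); last by rewrite s2 divff// gt_eqF.
  by rewrite /w; field.
transitivity (m * (rho ^+ 2 - (n ^+ 2 + m ^+ 2)) / s ^+ 2); first by field.
by rewrite rho2 subrr mulr0 mul0r.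
Qed.

Implicit Types (X Y Z : 'rV[R]_(2 + 2)) (V : 'rV[R]_2).

(* The value on [(X, Y)] of the 2-form [d<x, V> /\ d<y, V>]. *)
Definition frame_form V X Y : R :=
  inner (basepart X) V * inner (fibrepart Y) V
  - inner (basepart Y) V * inner (fibrepart X) V.

Lemma frame_formD V X Y :
  frame_form V X Y + frame_form (jrot V) X Y = - Omega X Y * inner V V.
Proof. by rewrite /frame_form OmegaE !innerE !mxE/=; ring. Qed.

(** With V read as a complex number, the right-hand side is Re (conj theta . V^2). On a Lagrangian
    surface the sum in [frame_formD] is zero, so both forms vanish as soon as V^2 is orthogonal to
    theta. *)
Lemma frame_formB V X Y :
  frame_form V X Y - frame_form (jrot V) X Y =
  thetar X Y * (V 0 0 ^+ 2 - V 0 1 ^+ 2) + thetai X Y * (2 * V 0 0 * V 0 1).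
Proof. by rewrite /frame_form /thetar /thetai !innerE !mxE/=; ring. Qed.

Definition base_area X Y : R :=
  basepart X 0 0 * basepart Y 0 1 - basepart X 0 1 * basepart Y 0 0.

(* On the surface, [d<y, V>] is [slope_num V X Y / base_area X Y] times
   [d<x, V>], see [frame_slope]. *)
Definition slope_num V X Y : R :=
  inner (fibrepart X) V * inner (basepart Y) (jrot V)
  - inner (fibrepart Y) V * inner (basepart X) (jrot V).

(** Where the base projection is regular, d<x, V> and d<x, jV> form a basis of the covectors; the
    vanishing of the frame form says that d<y, V> has no component on the second one. *)
Lemma frame_slope V X Y a b : inner V V = 1 -> base_area X Y != 0 ->
  frame_form V X Y = 0 ->
  let Z := a *: X + b *: Y in
  inner (fibrepart Z) V = slope_num V X Y / base_area X Y * inner (basepart Z) V.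
Proof.
move=> V1 D0 P0 Z; apply: (mulfI D0).
rewrite mulrA [base_area X Y * (_ / _)]mulrC divfK//.
(* The factor [inner V V] makes both sides cubic in V, so that their difference is an exact
   polynomial multiple of [frame_form V X Y]. *)
rewrite -[base_area X Y]mulr1 -V1; apply/subr0_eq.
transitivity (frame_form V X Y *
  (a * inner (basepart X) (jrot V) + b * inner (basepart Y) (jrot V))).
  rewrite /Z /frame_form /slope_num /base_area basepartD fibrepartD.
  rewrite !basepartZ !fibrepartZ !innerE !mxE/=.
  ring.
by rewrite P0 mul0r.
Qed.

Lemma linear_innerr V : linear (fun v : 'rV[R]_2 => inner v V : R^o).
Proof. by move=> a u v; rewrite !innerE !mxE -[RHS]/(a * _ + _); ring. Qed.

Lemma continuous_innerr V : continuous (fun v : 'rV[R]_2 => inner v V : R^o).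
Proof.
pose c i : 'rV[R]_2 -> R := fun v => v 0 i.
have cc i : continuous (c i : _ -> R^o) by move=> v; exact: coord_continuous.
rewrite (_ : (fun _ => _) = V 0 0 *: c 0 + V 0 1 *: c 1).
  by move=> v; apply: continuousD; apply: continuousZl_tmp; exact: cc.
by apply/funext => v; rewrite innerE mulrC [v 0 1 * _]mulrC.
Qed.

Lemma functional_basepart_inner V : functional (fun X => inner (basepart X) V).
Proof.
split=> [a X Y|X]; first by rewrite basepartD basepartZ linear_innerr.
apply: (@continuous_comp _ _ _ (@basepart R) (fun v => inner v V : R^o)).
  exact: continuous_lsubmx.
exact: continuous_innerr.
Qed.

Lemma functional_fibrepart_inner V : functional (fun X => inner (fibrepart X) V).
Proof.
split=> [a X Y|X]; first by rewrite fibrepartD fibrepartZ linear_innerr.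
apply: (@continuous_comp _ _ _ (@fibrepart R) (fun v => inner v V : R^o)).
  exact: continuous_rsubmx.
exact: continuous_innerr.
Qed.

Lemma theta_neq0_unit q X Y (A : 'M[R]_2) : A \in unitmx -> Omega X Y = 0 ->
  A 0 0 = GG q X X -> A 0 1 = GG q X Y -> A 1 0 = GG q Y X -> A 1 1 = GG q Y Y ->
  thetar X Y ^+ 2 + thetai X Y ^+ 2 != 0.
Proof.
move=> /mul_det2_invmx[+ _ _ _ _] O0 A00 A01 A10 A11.
rewrite A00 A01 A10 A11 (GG_sym _ Y X) -expr2 gram_theta O0 expr0n/= sub0r.
by rewrite oppr_eq0.
Qed.

(* [X] and [Y] stand for the first partial derivatives of a parametrization, and
   [A], [B], [C] for the second ones. *)
Lemma theta_stationary_algebra q X Y A B C :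
  Omega X Y = 0 -> Omega A Y + Omega X B = 0 -> Omega B Y + Omega X C = 0 ->
  (forall Z, Z = X \/ Z = Y -> GG q Y Y * Omega A Z
    - GG q X Y * (Omega B Z + Omega B Z) + GG q X X * Omega C Z = 0) ->
  (thetar X Y * (thetai A Y + thetai X B)
    - thetai X Y * (thetar A Y + thetar X B) = 0) /\
  (thetar X Y * (thetai B Y + thetai X C)
    - thetai X Y * (thetar B Y + thetar X C) = 0).
Proof.
move=> XY AY BY H; rewrite !(theta_derivation q) XY !mul0r !subr0.
(* The derivative of Omega X Y = 0 gives the symmetries that, with the equality of mixed
   derivatives, make Omega(D_i X_j, X_k) totally symmetric. The two derivatives of theta then become
   the two components of the equation H = 0. *)
move: AY BY; rewrite (OmegaC B X) (OmegaC C X) => /subr0_eq AY /subr0_eq BY.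
have HX := H X (or_introl erefl); have HY := H Y (or_intror erefl).
rewrite AY BY in HX HY *.
by split; apply/eqP; rewrite oppr_eq0; apply/eqP;
  [rewrite -[RHS]HX|rewrite -[RHS]HY]; ring.
Qed.

End Frame.

Section MinimalLagrangianChart.
Variables (R : realType) (U : set 'rV[R]_2) (F : 'rV[R]_2 -> 'rV[R]_(2 + 2)).
Hypotheses (oU : open U) (FC : class_C 2 U F).
Hypothesis lagr : forall p, U p -> forall v w, Omega ('D_v F p) ('D_w F p) = 0.
Hypothesis nonnull : forall p, U p -> induced_mx (@GG R) F p \in unitmx.
Hypothesis mini : forall p, U p -> mean_curvature (@GG R) F p = 0.

Let X i := partial F i.
Let thr p := thetar (X 0 p) (X 1 p).
Let thi p := thetai (X 0 p) (X 1 p).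

Let dX i p : U p -> differentiable (X i) p.
Proof. by move=> Up; have [_ DF] := FC; have [+ _] := DF (stdvec R i); exact. Qed.

Lemma theta_neq0 p : U p -> thr p ^+ 2 + thi p ^+ 2 != 0.
Proof.
move=> Up.
have ME i j : induced_mx (@GG R) F p i j = GG (F p) (X i p) (X j p) by rewrite mxE.
by apply: (theta_neq0_unit (nonnull Up) (lagr Up _ _)); exact: ME.
Qed.

Lemma theta_stationary p v : U p ->
  thr p * 'D_v (thi : _ -> R^o) p - thi p * 'D_v (thr : _ -> R^o) p = 0.
Proof.
move=> Up.
have [dr Dr] := @leibniz_thetar R _ (X 0) (X 1) p (dX 0 Up) (dX 1 Up).
have [di Di] := @leibniz_thetai R _ (X 0) (X 1) p (dX 0 Up) (dX 1 Up).
have [dO DO] := @leibniz_Omega R _ (X 0) (X 1) p (dX 0 Up) (dX 1 Up).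
have O0 k : Omega ('D_(stdvec R k) (X 0) p) (X 1 p)
    + Omega (X 0 p) ('D_(stdvec R k) (X 1) p) = 0.
  rewrite -DO (near_eq_derive (g := cst (0 : R^o))) ?derive_cst//.
  by apply: open_near_eq oU _ Up => q Uq; exact: lagr.
have sym : 'D_(stdvec R 1) (X 0) p = 'D_(stdvec R 0) (X 1) p.
  exact: (class_C2_derive_comm_rV (stdvec R 0) (stdvec R 1) oU Up FC).
have H := minimal_Omega (nonnull Up) (fun i j => lagr Up _ _) (mini Up).
set a := 'D_(stdvec R 0) (X 0) p; set b := 'D_(stdvec R 0) (X 1) p.
set c := 'D_(stdvec R 1) (X 1) p.
have O1 : Omega b (X 1 p) + Omega (X 0 p) c = 0.
  exact: etrans (congr1 (fun z => Omega z (X 1 p) + Omega (X 0 p) c) (esym sym)) (O0 1).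
have HZ Z : Z = X 0 p \/ Z = X 1 p -> GG (F p) (X 1 p) (X 1 p) * Omega a Z
    - GG (F p) (X 0 p) (X 1 p) * (Omega b Z + Omega b Z)
    + GG (F p) (X 0 p) (X 0 p) * Omega c Z = 0.
  pose f z := GG (F p) (X 1 p) (X 1 p) * Omega a Z
    - GG (F p) (X 0 p) (X 1 p) * (Omega b Z + Omega z Z)
    + GG (F p) (X 0 p) (X 0 p) * Omega c Z.
  move=> ZX; apply: (etrans (congr1 f (esym sym))); rewrite /f.
  by case: ZX => ->; [exact: (H 0)|exact: (H 1)].
have [S0 S1] := theta_stationary_algebra (lagr Up _ _) (O0 0) O1 HZ.
have Dk : forall k, thr p * 'D_(stdvec R k) (thi : _ -> R^o) p
    - thi p * 'D_(stdvec R k) (thr : _ -> R^o) p = 0.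
  move=> k; apply: etrans (congr2 (fun x y => thr p * x - thi p * y) (Di _) (Dr _)) _.
  have [->|->] := ord2P k; first exact: S0.
  pose f z := thr p * (thetai z (X 1 p) + thetai (X 0 p) c)
    - thi p * (thetar z (X 1 p) + thetar (X 0 p) c).
  exact: etrans (congr1 f sym) S1.
have lin (x y : R) (f g : 'I_2 -> R^o) : (forall k, x * g k - y * f k = 0) ->
    x * (\sum_k v 0 k *: g k) - y * (\sum_k v 0 k *: f k) = 0.
  move=> fg0; transitivity (v 0 0 * (x * g 0 - y * f 0) + v 0 1 * (x * g 1 - y * f 1)).
    rewrite (sum2 (fun k => v 0 k * g k)) (sum2 (fun k => v 0 k * f k)); ring.
  by rewrite !fg0 !mulr0 addr0.
rewrite (derive_coord v dr) (derive_coord v di); exact: lin Dk.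
Qed.

(** The ball is taken so small that theta keeps a positive scalar product [n] with its value at p0;
    [wronskian0_parallel] then applies along the segment from p0 to p. *)
Lemma theta_parallel p0 : U p0 -> exists2 r : R, 0 < r &
  ball p0 r `<=` U /\ forall p, ball p0 r p -> thr p * thi p0 = thi p * thr p0.
Proof.
move=> Up0.
have dthr p : U p -> differentiable (thr : _ -> R^o) p.
  by move=> Up; have [] := @leibniz_thetar R _ (X 0) (X 1) p (dX 0 Up) (dX 1 Up).
have dthi p : U p -> differentiable (thi : _ -> R^o) p.
  by move=> Up; have [] := @leibniz_thetai R _ (X 0) (X 1) p (dX 0 Up) (dX 1 Up).
pose n : 'rV[R]_2 -> R^o := thr p0 *: (thr : _ -> R^o) + thi p0 *: (thi : _ -> R^o).
have nE p : n p = thr p * thr p0 + thi p * thi p0.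
  have swap (x y z t : R) : x * y + z * t = y * x + t * z by ring.
  exact: (swap (thr p0) (thr p)).
have nc : {for p0, continuous n}.
  apply: continuousD; apply: continuousZl_tmp; apply: differentiable_continuous.
    exact: dthr.
  exact: dthi.
have n0 : 0 < n p0.
  by rewrite nE lt_def theta_neq0// addr_ge0// -expr2 sqr_ge0.
have n_near : \forall p \near p0, 0 < n p.
  by move/cvgr_gt : nc; exact.
have nU : nbhs p0 U by exact: open_nbhs_nbhs.
have : \forall p \near p0, U p /\ 0 < n p by apply: filterS2 nU n_near => p; split.
move=> /nbhs_ballP[r /= r0 rP]; exists r => //; split=> [p /rP[]//|p pr].
have line (t : R) : 0 <= t <= 1 -> U (p0 + t *: (p - p0)) /\ 0 < n (p0 + t *: (p - p0)).
  move=> t01; apply: rP; apply: ball_line => //; first exact: ballxx.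
  by rewrite addrC subrK.
pose a (t : R) : R := thr (p0 + t *: (p - p0)).
pose b (t : R) : R := thi (p0 + t *: (p - p0)).
have line0 : p0 + 0 *: (p - p0) = p0 by rewrite scale0r addr0.
have line1 : p0 + 1 *: (p - p0) = p by rewrite scale1r addrC subrK.
have a0 : a 0 = thr p0 := congr1 thr line0.
have b0 : b 0 = thi p0 := congr1 thi line0.
have a1 : a 1 = thr p := congr1 thr line1.
have b1 : b 1 = thi p := congr1 thi line1.
rewrite -a0 -b0 -a1 -b1.
apply: (@wronskian0_parallel R a b
  (fun t => 'D_(p - p0) (thr : _ -> R^o) (p0 + t *: (p - p0)))
  (fun t => 'D_(p - p0) (thi : _ -> R^o) (p0 + t *: (p - p0)))) => t t01.
- by apply: (is_derive_line (f := (thr : _ -> R^o))); apply: dthr; have [] := line t t01.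
- by apply: (is_derive_line (f := (thi : _ -> R^o))); apply: dthi; have [] := line t t01.
- by apply: theta_stationary; have [] := line t t01.
- by rewrite a0 b0; have [_] := line t t01; rewrite nE => /lt0r_neq0.
Qed.

Lemma local_frame p0 : U p0 -> exists r V, [/\ 0 < r, ball p0 r `<=` U, inner V V = 1 &
  forall p, ball p0 r p ->
    frame_form V (X 0 p) (X 1 p) = 0 /\ frame_form (jrot V) (X 0 p) (X 1 p) = 0].
Proof.
move=> Up0; have [r r0 [rU par]] := theta_parallel Up0.
have [V [V1 VE]] := exists_frame (thr p0) (thi p0).
exists r, V; split=> // p pr.
have := frame_formD V (X 0 p) (X 1 p); have := frame_formB V (X 0 p) (X 1 p).
rewrite (lagr (rU _ pr)) oppr0 mul0r -/(thr p) -/(thi p).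
have -> : thr p * (V 0 0 ^+ 2 - V 0 1 ^+ 2) + thi p * (2 * V 0 0 * V 0 1) = 0.
  have := theta_neq0 Up0; move: VE (par p pr); move: (thr p0) (thi p0) (thr p) (thi p).
  move: (V 0 0 ^+ 2 - V 0 1 ^+ 2) (2 * V 0 0 * V 0 1) => x y m n m' n' mn par' nz.
  (* Theta at p is decomposed along theta at p0 and its quarter turn: the first component meets the
     choice of V, the second vanishes by parallelism. *)
  apply: (mulfI nz); rewrite mulr0.
  transitivity ((m * m' + n * n') * (m * x + n * y)
    + (m' * n - n' * m) * (n * x - m * y)); first by ring.
  by rewrite mn par' subrr mulr0 mul0r addr0.
by move: (frame_form V _ _) (frame_form (jrot V) _ _) => P Q PQ1 PQ2; split; lra.
Qed.

End MinimalLagrangianChart.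

Lemma is_derive_of_bound (R : realType) (G : R -> R) (t l : R) :
  (forall e : R, 0 < e ->
    \forall s \near t, `|G s - G t - l * (s - t)| <= e * `|s - t|) ->
  is_derive t 1 G l.
Proof.
move=> Gl.
have cvg_l : (h^-1 *: ((G \o shift t) (h *: (1 : R)) - G t)) @[h --> 0^'] --> l.
  apply/cvgrPdist_le => e e0; have := Gl e e0; rewrite (near_shift 0) subr0.
  move=> G0; rewrite /dnbhs near_withinE.
  apply: filterS G0 => h /=; rewrite addrK => Gh h0.
  have hp : 0 < `|h| by rewrite normr_gt0.
  rewrite -(ler_pM2r hp) -normrM.
  rewrite -(normrN ((l - _) * h)) -mulNr opprB mulrBl [h *: _]mulr1.
  by rewrite [h^-1 *: _ * _]mulrAC mulVf// mul1r.
split; first by apply/cvg_ex; exists l.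
exact/cvg_lim.
Qed.

Section Slopes.
Variables (R : realType) (U : set 'rV[R]_2) (F : 'rV[R]_2 -> 'rV[R]_(2 + 2)).
Hypotheses (oU : open U) (FC : class_C 2 U F).

Let X i := partial F i.

Let dX i p : U p -> differentiable (X i) p.
Proof. by move=> Up; have [_ DF] := FC; have [+ _] := DF (stdvec R i); exact. Qed.

Lemma base_area_neq0 p : U p -> \rank ('J (@basepart R \o F) p) = 2%N ->
  base_area (X 0 p) (X 1 p) != 0.
Proof.
move=> Up rk; have [dF _] := FC.
have bl : linear (@basepart R) by move=> a x y; rewrite basepartD basepartZ.
have bc : continuous (@basepart R) by exact: continuous_lsubmx.
have Ju : 'J (@basepart R \o F) p \in unitmx by rewrite -row_free_unit /row_free rk.
have JE i k : 'J (@basepart R \o F) p i k = basepart (X i p) 0 k.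
  have -> : basepart (X i p) = 'D_(stdvec R i) (@basepart R \o F) p.
    by rewrite derive_linear_comp//; exact: dF.
  rewrite (deriveEjacobian _ (differentiable_linear_comp bl bc (dF _ Up))).
  by rewrite /stdvec -rowE [RHS]mxE.
have [+ _ _ _ _] := mul_det2_invmx Ju; move: ('J _ p) JE => A AE; by rewrite !AE.
Qed.

Lemma slope_continuous V p : U p -> base_area (X 0 p) (X 1 p) != 0 ->
  {for p, continuous (fun q => slope_num V (X 0 q) (X 1 q) / base_area (X 0 q) (X 1 q))}.
Proof.
move=> Up D0.
have ls : @leibniz R 'rV[R]_2 _ (@slope_num R V).
  apply: leibnizB; [apply: leibnizM|apply: leibnizMC];
    by [exact: functional_fibrepart_inner|exact: functional_basepart_inner].
have la : @leibniz R 'rV[R]_2 _ (@base_area R).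
  by apply: leibnizB; apply: leibnizM; exact: functional_basepart.
have [ds _] := ls _ _ _ (dX 0 Up) (dX 1 Up).
have [da _] := la _ _ _ (dX 0 Up) (dX 1 Up).
have cs := differentiable_continuous ds; have ca := differentiable_continuous da.
have cV := continuousV (s := fun q => base_area (X 0 q) (X 1 q)) D0 ca.
exact: (continuousM cs cV).
Qed.

Lemma slope_derive V p v : U p -> inner V V = 1 ->
  base_area (X 0 p) (X 1 p) != 0 -> frame_form V (X 0 p) (X 1 p) = 0 ->
  'D_v (fun q => inner (fibrepart (F q)) V : R^o) p =
  slope_num V (X 0 p) (X 1 p) / base_area (X 0 p) (X 1 p)
    * 'D_v (fun q => inner (basepart (F q)) V : R^o) p.
Proof.
move=> Up V1 D0 P0; have [dF _] := FC.
have [fl fc] := functional_fibrepart_inner V; have [bl bc] := functional_basepart_inner V.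
apply: (etrans (derive_linear_comp fl fc v (dF _ Up))).
apply: (etrans _ (congr1 (fun z => _ * z) (esym (derive_linear_comp bl bc v (dF _ Up))))).
have -> : 'D_v F p = v 0 0 *: X 0 p + v 0 1 *: X 1 p.
  rewrite (derive_coord _ (dF _ Up)).
  rewrite big_ord_recl big_ord1.
  by congr (_ + v 0 _ *: 'D_(stdvec R _) F p); exact: val_inj.
exact: frame_slope.
Qed.

End Slopes.

(** * The fibre part as a function of the base point *)

Section LocalInverse.
Variables (R : realType) (U B D : set 'rV[R]_2) (phi Q : 'rV[R]_2 -> 'rV[R]_2) (C : R).
Hypotheses (oU : open U) (oD : open D) (BU : B `<=` U) (C0 : 0 < C).
Hypothesis phi_lip : forall p q, B p -> B q -> `|q - p| <= C * `|phi q - phi p|.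
Hypothesis QP : forall x, D x -> B (Q x) /\ phi (Q x) = x.

Lemma near_line x w t : D (x + t *: w) -> \forall s \near t, D (x + s *: w).
Proof.
move=> Dt; have lc : {for t, continuous (fun s : R => x + s *: w)}.
  by apply: cvgD; [exact: cvg_cst|apply: cvgZr_tmp; exact: cvg_id].
by apply: lc; exact: open_nbhs_nbhs.
Qed.

Lemma section_line_lip x w s t : D (x + s *: w) -> D (x + t *: w) ->
  `|Q (x + s *: w) - Q (x + t *: w)| <= C * `|w| * `|s - t|.
Proof.
move=> /QP[Bs es] /QP[Bt et]; rewrite (le_trans (phi_lip Bt Bs))// es et.
by rewrite opprD addrACA subrr add0r -scalerBl normrZ mulrAC mulrA.
Qed.

Lemma section_line_continuous x w t : D (x + t *: w) ->
  {for t, continuous (fun s : R => Q (x + s *: w))}.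
Proof.
move=> Dt; apply/cvgrPdist_lt => e e0.
have K0 : 0 < C * `|w| + 1 by rewrite ltr_wpDl// mulr_ge0// ltW.
have eK : 0 < e / (C * `|w| + 1) by rewrite divr_gt0.
have := @nbhsx_ballx R R t _ eK; rewrite -ball_normE /ball_ /=.
apply: filterS2 (near_line Dt) => s Ds ts.
rewrite (le_lt_trans (section_line_lip Dt Ds))//.
rewrite (@le_lt_trans _ _ ((C * `|w| + 1) * `|t - s|)) ?ler_wpM2r ?lerDl//.
by rewrite mulrC -ltr_pdivlMr.
Qed.

(** At p = Q(x + t w) the increments of psi and of a <phi, V> agree up to o(|z - p|), and <phi, V>
    along the section is affine in s with slope <w, V>. The Lipschitz bound on Q, in place of a
    derivative of Q, turns o(|z - p|) into o(|s - t|). *)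
Lemma section_line_derive (psi : 'rV[R]_2 -> R^o) V (a : R) x w t :
  class_C 1 U psi -> class_C 1 U (fun q => inner (phi q) V : R^o) -> D (x + t *: w) ->
  (forall v, 'D_v psi (Q (x + t *: w)) =
    a * 'D_v (fun q => inner (phi q) V : R^o) (Q (x + t *: w))) ->
  is_derive t 1 (fun s => psi (Q (x + s *: w))) (a * inner w V).
Proof.
move=> psiC chiC Dt psi_chi; set p := Q (x + t *: w).
have [Bp phip] := QP Dt; have Up := BU Bp.
apply: is_derive_of_bound => e e0.
(* The first factor adds the error on psi and |a| times the error on <phi, V>; the second bounds the
   Lipschitz constant of Q along the line, increased by 1 to be positive. *)
pose K := (1 + `|a|) * (C * `|w| + 1).
have K1 : 0 < 1 + `|a| by rewrite ltr_pwDl.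
have K2 : 0 < C * `|w| + 1 by rewrite ltr_wpDl// mulr_ge0// ltW.
have K0 : 0 < K := mulr_gt0 K1 K2.
have eK : 0 < e / K by rewrite divr_gt0.
have Spsi := class_C1_strict_diff oU Up psiC eK.
have Schi := class_C1_strict_diff oU Up chiC eK.
near (0 : R)^'+ => d.
have d0 : 0 < d by near: d; exact: nbhs_right_gt.
have Sd : forall y z, ball p d y -> ball p d z ->
    `|psi z - psi y - 'D_(z - y) psi p| <= e / K * `|z - y|.
  by near: d; exact: Spsi.
have Td : forall y z, ball p d y -> ball p d z ->
    `|inner (phi z) V - inner (phi y) V
      - 'D_(z - y) (fun q => inner (phi q) V : R^o) p| <= e / K * `|z - y|.
  by near: d; exact: Schi.
have pd : \forall s \near t, ball p d (Q (x + s *: w)).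
  by apply: (section_line_continuous Dt); exact: nbhsx_ballx.
apply: filterS2 (near_line Dt) pd => s Ds pz.
have pp := ballxx p d0.
have := Sd _ _ pp pz; have := Td _ _ pp pz; have := section_line_lip Ds Dt.
have [_ ->] := QP Ds; rewrite phip -/p psi_chi.
have -> : inner (x + s *: w) V - inner (x + t *: w) V = (s - t) * inner w V.
  by rewrite !innerE !mxE; ring.
move: (Q (x + s *: w)) ('D_(_ - p) _ p) => z dchi.
move: (psi z - psi p) => dpsi zp chi_le psi_le.
have -> : dpsi - a * inner w V * (s - t) =
  (dpsi - a * dchi) - a * ((s - t) * inner w V - dchi) by ring.
rewrite (le_trans (ler_normB _ _))// normrM.
have Ke : e / K * ((1 + `|a|) * `|z - p|) <= e * `|s - t|.
  have -> : e / K * ((1 + `|a|) * `|z - p|) = e * (`|z - p| / (C * `|w| + 1)).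
    by rewrite /K; field; rewrite !gt_eqF.
  by rewrite ler_wpM2l ?(ltW e0)// ler_pdivrMr// (le_trans zp)// mulrC ler_wpM2l// lerDl.
rewrite (le_trans (lerD psi_le (ler_wpM2l (normr_ge0 a) chi_le)))//.
by apply: le_trans Ke; rewrite le_eqVlt; apply/orP; left; apply/eqP; ring.
Unshelve. all: by end_near. Qed.

End LocalInverse.

Lemma unit_norm_le (R : realType) (V : 'rV[R]_2) : inner V V = 1 -> `|V| <= 1.
Proof.
rewrite innerE -!expr2 => V1; apply: rV_norm_le => // j.
rewrite -(@ler_pXn2r _ 2) ?nnegrE// expr1n -normrX ger0_norm ?sqr_ge0// -V1.
by have [->|->] := ord2P j; rewrite ?lerDl ?lerDr sqr_ge0.
Qed.

Lemma inner_le (R : realType) (v V : 'rV[R]_2) : inner V V = 1 ->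
  `|inner v V| <= 2 * `|v|.
Proof.
move=> V1; rewrite innerE (le_trans (ler_normD _ _))// mulr2n mulrDl mul1r.
have Vj j : `|V 0 j| <= 1 by exact: le_trans (rV_coord_le V j) (unit_norm_le V1).
by apply: lerD; rewrite normrM -[leRHS]mulr1 ler_pM ?rV_coord_le ?Vj.
Qed.

Section LevelFunction.
Variables (R : realType) (U B : set 'rV[R]_2) (phi Q : 'rV[R]_2 -> 'rV[R]_2).
Variables (C rho : R) (x0 : 'rV[R]_2).
Hypotheses (oU : open U) (BU : B `<=` U) (C0 : 0 < C) (rho0 : 0 < rho).
Hypothesis phi_lip : forall p q, B p -> B q -> `|q - p| <= C * `|phi q - phi p|.
Hypothesis QP : forall x, ball x0 rho x -> B (Q x) /\ phi (Q x) = x.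

(** The derivative of psi o Q along w is a multiple of <w, V>, so psi o Q is constant on segments
    orthogonal to V. Its restriction to a line of direction V is a C^1 germ with derivative alpha o
    Q, and f is a primitive of that germ. *)
Lemma level_function (psi alpha : 'rV[R]_2 -> R) V : inner V V = 1 ->
  class_C 1 U (psi : _ -> R^o) -> class_C 1 U (fun q => inner (phi q) V : R^o) ->
  (forall p, B p -> {for p, continuous alpha}) ->
  (forall p v, B p ->
    'D_v (psi : _ -> R^o) p = alpha p * 'D_v (fun q => inner (phi q) V : R^o) p) ->
  exists f : R -> R, [/\ class_C 2 setT (f : R^o -> R^o), nonconstant f &
    forall x, ball x0 (rho / 8) x -> is_derive (inner x V) 1 f (psi (Q x))].
Proof.
move=> V1 psiC chiC ac psi_chi.
have psi_line x w t : ball x0 rho (x + t *: w) ->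
    is_derive t 1 (fun s => psi (Q (x + s *: w))) (alpha (Q (x + t *: w)) * inner w V).
  move=> Dt; have oD := @ball_open _ _ x0 rho.
  apply: (section_line_derive oU oD BU C0 phi_lip QP psiC chiC Dt).
  by move=> v; apply: psi_chi; have [] := QP Dt.
(* The line through x0 in the direction V, parametrized so that <y t, V> = t. *)
pose t0 := inner x0 V; pose y t := x0 - t0 *: V + t *: V.
have yE t : x0 - y t = (t0 - t) *: V.
  by rewrite /y scalerBl !opprD opprK !addrA subrr add0r.
have yD t : `|t - t0| < rho -> ball x0 rho (y t).
  move=> tr; rewrite -ball_normE/= yE normrZ distrC.
  by rewrite (le_lt_trans _ tr)// ler_piMr// unit_norm_le.
have r0 : 0 < rho / 2 by rewrite divr_gt0.
have r2 : 2 * (rho / 2) = rho by field.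
have dh t : `|t - t0| < 2 * (rho / 2) ->
    is_derive t 1 (fun s => psi (Q (y s))) (alpha (Q (y t))).
  by rewrite r2 => /yD yt; have := psi_line _ V t yt; rewrite V1 mulr1.
have kc t : `|t - t0| < 2 * (rho / 2) -> {for t, continuous (fun s => alpha (Q (y s)))}.
  rewrite r2 => /yD yt; apply: (@continuous_comp _ _ _ (fun s => Q (y s)) alpha).
    exact: (section_line_continuous (@ball_open _ _ x0 rho) C0 phi_lip QP yt).
  by apply: ac; have [] := QP yt.
have [f [fC fn df]] := C1_germ_primitive r0 dh kc.
exists f; split=> // x xr; set t := inner x V.
have xD : ball x0 rho x by apply: le_ball xr; rewrite ler_pdivrMr// ler_peMr ?ler1n// ltW.
(* In the sup norm |<v, V>| <= 2 |v|, so the radius rho / 8 puts t within rho / 4 of t0, inside the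
   interval where f' is prescribed. *)
have tr : `|t - t0| < rho / 2.
  have -> : t - t0 = inner (x - x0) V by rewrite /t /t0 !innerE !mxE; ring.
  rewrite (le_lt_trans (inner_le _ V1))//; move: xr; rewrite -ball_normE/= distrC => xr.
  by rewrite -ltr_pdivlMl//; move: xr; lra.
have yt : ball x0 rho (y t) by apply: yD; lra.
suff -> : psi (Q x) = psi (Q (y t)) by exact: df.
have yx : y t + (x - y t) = x by rewrite addrC subrK.
have w0 : inner (x - y t) V = 0.
  have -> : inner (x - y t) V = t - t0 + t0 * inner V V - t * inner V V.
    by rewrite /y /t /t0 !innerE !mxE; ring.
  by rewrite V1; ring.
have dw (s : R) : 0 <= s <= 1 ->
    is_derive s 1 (fun s => psi (Q (y t + s *: (x - y t)))) 0.
  move=> s01; rewrite -(mulr0 (alpha (Q (y t + s *: (x - y t))))) -w0.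
  by apply: psi_line; apply: ball_line => //; rewrite yx.
have wc : {within `[0, 1], continuous (fun s : R => psi (Q (y t + s *: (x - y t))))}.
  by apply: derivable_within_continuous => s; rewrite in_itv/= => /dw[].
have dw' (s : R) : s \in `]0, 1[ ->
    is_derive s 1 (fun s => psi (Q (y t + s *: (x - y t)))) 0.
  by rewrite in_itv/= => /andP[s0 s1]; apply: dw; rewrite !ltW.
have [s _] := MVT ltr01 dw' wc.
by rewrite scale1r yx scale0r addr0 mul0r => /subr0_eq.
Qed.

End LevelFunction.

(** * Gradients of ridge functions and the surface as a graph *)

Lemma sub_class_C (R : realType) (V W : normedModType R) k (U B : set V) (f : V -> W) :
  B `<=` U -> class_C k U f -> class_C k B f.
Proof.
move=> BU; elim: k f => [|k IH] f /=; first by move=> fc x /BU; exact: fc.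
by move=> [df Df]; split=> [x /BU|v]; [exact: df|exact: IH].
Qed.

Section Gradient.
Variable R : realType.
Implicit Types (V v x : 'rV[R]_2).

Lemma inner_jrot V : inner (jrot V) (jrot V) = inner V V.
Proof. by rewrite !innerE !mxE/=; ring. Qed.

Lemma frame_decomposition V x : inner V V = 1 ->
  inner x V *: V + inner x (jrot V) *: jrot V = x.
Proof.
move=> V1; apply/rowP => i; rewrite !innerE !mxE.
rewrite innerE in V1.
have [->|->] := ord2P i; rewrite /= -[RHS]mulr1 -V1; ring.
Qed.

Lemma is_derive_ridge (f : R -> R) V v x (a : R) : is_derive (inner x V) 1 f a ->
  differentiable (fun y => f (inner y V) : R^o) x /\
  'D_v (fun y => f (inner y V) : R^o) x = inner v V * a.
Proof.
move=> [fd fa].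
have [ld lE] := is_diff_linear (@linear_innerr R V) (@continuous_innerr R V) x.
have df : differentiable (f : R^o -> R^o) (inner x V) by exact/derivable1_diffP.
have dfl := differentiable_comp ld df.
split; first exact: dfl.
rewrite (deriveE _ dfl) (diff_comp ld df) /= lE -(deriveE _ df).
by rewrite -[X in derive _ _ X]mulr1 (deriveZv _ _ df) fa.
Qed.

Lemma grad_ridges (f1 f2 : R -> R) V x (a1 a2 : R) : 
  is_derive (inner x V) 1 f1 a1 -> is_derive (inner x (jrot V)) 1 f2 a2 ->
  grad (fun y => f1 (inner y V) + f2 (inner y (jrot V))) x = a1 *: V + a2 *: jrot V.
Proof.
move=> d1 d2; apply/rowP => i; rewrite [LHS]mxE [RHS]mxE [in RHS]mxE [X in _ = _ + X]mxE.
have [e1 E1] := is_derive_ridge (stdvec R i) d1.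
have [e2 E2] := is_derive_ridge (stdvec R i) d2.
rewrite (deriveD (diff_derivable e1) (diff_derivable e2)) E1 E2.
have iE W : inner (stdvec R i) W = W 0 i.
  by rewrite innerE !mxE; have [->|->] := ord2P i; rewrite /= ?mul0r ?mul1r ?addr0 ?add0r.
by rewrite !iE mulrC [_ * a2]mulrC.
Qed.

End Gradient.

Section MinimalLagrangian.
Variable R : realType.

Lemma minimal_lagrangian_ridges (L : set 'rV[R]_(2 + 2)) :
  surface L -> non_null L -> rank_two L -> lagrangian L -> minimal L ->
  forall q, L q ->
  exists (O : set 'rV[R]_(2 + 2)) (W : set 'rV[R]_2) (V : 'rV[R]_2) (f1 f2 : R -> R),
    let u p := f1 (inner p V) + f2 (inner p (jrot V)) in
    [/\ open O /\ O q, open W, [set row_mx p (grad u p) | p in W] = L `&` O &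
      [/\ inner V V = 1, class_C 2 setT (f1 : R^o -> R^o),
        class_C 2 setT (f2 : R^o -> R^o) & nonconstant f1 /\ nonconstant f2]].
Proof.
move=> Ls Ln Lr Ll Lm q Lq.
have [U [N [F [ch Nq]]]] := Ls q Lq.
have [[oU oO] FC rkF FU [Finv Finvc FK]] := ch.
have lagr := Ll U N F ch; have nn := Ln U N F ch.
have rk := Lr U N F ch; have mini := Lm U N F ch.
have [p0 Up0 Fp0] : (F @` U) q by rewrite FU.
have [r1 [V [r10 r1U V1 VP]]] := local_frame oU FC lagr nn mini Up0.
have jV1 : inner (jrot V) (jrot V) = 1 by rewrite inner_jrot.
have oB1 : open (ball p0 r1) by exact: ball_open.
have bl : linear (@basepart R) by move=> a x y; rewrite basepartD basepartZ.
have bc : continuous (@basepart R) by exact: continuous_lsubmx.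
have FC1 : class_C 2 (ball p0 r1) F := sub_class_C r1U FC.
have comp1 (l : 'rV[R]_(2 + 2) -> R) : functional l ->
    class_C 1 (ball p0 r1) (l \o F : _ -> R^o).
  by move=> [ll lc]; exact: (class_C_linear_comp ll lc oB1 (class_CW FC1)).
pose phi := @basepart R \o F.
have phiC : class_C 1 (ball p0 r1) phi := class_C_linear_comp bl bc oB1 (class_CW FC1).
have Ju : 'J phi p0 \in unitmx by rewrite -row_free_unit /row_free rk.
have [r [C [rho [r0 C0 rho0 BB1 [phi_lip phi_surj]]]]] :=
  inverse_function oB1 (ballxx p0 r10) phiC Ju.
set B := ball p0 r in BB1 phi_lip phi_surj.
have BU : B `<=` U by exact: subset_trans BB1 r1U.
set x0 := phi p0 in phi_surj.
(* Choice needs a total function; away from the ball the default value is p0. *)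
have /choice[Q QP] : forall x, exists p, ball x0 rho x -> B p /\ phi p = x.
  move=> x; have [/phi_surj[p Bp <-]|nx] := pselect (ball x0 rho x); first by exists p.
  by exists p0.
have area0 p : B p -> base_area (partial F 0 p) (partial F 1 p) != 0.
  by move=> /BU Up; exact: (base_area_neq0 FC Up (rk p Up)).
have level V' : inner V' V' = 1 ->
    (forall p, B p -> frame_form V' (partial F 0 p) (partial F 1 p) = 0) ->
    exists f : R -> R, [/\ class_C 2 setT (f : R^o -> R^o), nonconstant f &
      forall x, ball x0 (rho / 8) x ->
        is_derive (inner x V') 1 f (inner (fibrepart (F (Q x))) V')].
  move=> V'1 fr.
  apply: (level_function (psi := fun p => inner (fibrepart (F p)) V')
    (alpha := fun p => slope_num V' (partial F 0 p) (partial F 1 p)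
                       / base_area (partial F 0 p) (partial F 1 p))
    oB1 BB1 C0 rho0 phi_lip QP V'1).
  - exact: comp1 (functional_fibrepart_inner V').
  - exact: comp1 (functional_basepart_inner V').
  - by move=> p Bp; exact: (slope_continuous FC (BU _ Bp) (area0 _ Bp)).
  - by move=> p v Bp; exact: (slope_derive FC v (BU _ Bp) V'1 (area0 _ Bp) (fr _ Bp)).
have [f1 [f1C f1n df1]] := level V V1 (fun p Bp => (VP p (BB1 _ Bp)).1).
have [f2 [f2C f2n df2]] := level (jrot V) jV1 (fun p Bp => (VP p (BB1 _ Bp)).2).
have gradE x : ball x0 (rho / 8) x ->
    grad (fun p => f1 (inner p V) + f2 (inner p (jrot V))) x = fibrepart (F (Q x)).
  by move=> xr; rewrite (grad_ridges (df1 x xr) (df2 x xr)) frame_decomposition.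
have oB : open B by exact: ball_open.
(* As the chart is a homeomorphism onto its image, some open set of the ambient space cuts F(B) out
   of L [&] N. Without this cut, another sheet of L could lie over the same base points. *)
have [N1 oN1 N1E] : exists2 N1 : set 'rV[R]_(2 + 2), open N1 &
    N1 `&` (L `&` N) = Finv @^-1` B `&` (L `&` N).
  by apply/open_subspaceP; move/continuousP : Finvc; apply.
have rho8 : rho / 8 <= rho by rewrite ler_pdivrMr// ler_peMr ?ler1n// ltW.
exists (N `&` N1 `&` (@basepart R) @^-1` ball x0 (rho / 8)), (ball x0 (rho / 8)).
exists V, f1, f2.
have N1F p : U p -> N1 (F p) <-> B p.
  move=> Up; have LOF : (L `&` N) (F p) by rewrite -FU; exists p.
  have := congr1 (fun S : set _ => S (F p)) N1E; rewrite /setI/= FK// => E.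
  split=> [N1p|Bp]; first by have [] : B p /\ (L (F p) /\ N (F p)) by rewrite -E.
  by have [] : N1 (F p) /\ (L (F p) /\ N (F p)) by rewrite E.
split=> //.
- split.
    apply: openI; first exact: openI.
    by apply: open_comp => [? _|]; [exact: bc|exact: ball_open].
  split; last by rewrite /= -Fp0; apply: ballxx; rewrite divr_gt0.
  by split=> //; rewrite -Fp0; apply/N1F => //; exact: ballxx.
- exact: ball_open.
- apply/seteqP; split=> [_ [x xr <-]|z [Lz [[Oz N1z] zr]]].
    have [BQ phiQ] := QP x (le_ball rho8 xr).
    have -> : row_mx x (grad (fun p => f1 (inner p V) + f2 (inner p (jrot V))) x)
      = F (Q x).
      by rewrite gradE// -{1}phiQ /phi /basepart /fibrepart /= hsubmxK.
    have [LF OF] : (L `&` N) (F (Q x)) by rewrite -FU; exists (Q x) => //; exact: BU.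
    split=> //; split; first by split=> //; apply/N1F => //; exact: BU.
    exact: (eq_ind_r (ball x0 (rho / 8)) xr phiQ).
  have [p Up pz] : (F @` U) z by rewrite FU.
  have Bp : B p by apply/N1F => //; rewrite pz.
  have phip : phi p = basepart z by rewrite /phi /= pz.
  exists (basepart z) => //.
  have [BQ phiQ] := QP _ (le_ball rho8 zr).
  (* The Lipschitz bound makes phi injective on B, so the section returns the parameter of z
     itself. *)
  have Qp : Q (basepart z) = p.
    apply/subr0_eq/normr0_eq0/eqP; rewrite eq_le normr_ge0 andbT.
    by rewrite (le_trans (phi_lip _ _ Bp BQ))// phiQ phip subrr normr0 mulr0.
  by rewrite gradE// Qp pz /basepart /fibrepart hsubmxK.
Qed.

End MinimalLagrangian.

Theorem theorem2 (R : realType) :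
  [/\ pseudo_metric (@GG R), flat (@GG R)
    & forall q : 'rV[R]_(2 + 2),
        @has_signature R 2 2 (metric_mx (@GG R) q)]
  /\
  forall L : set 'rV[R]_(2 + 2),
    surface L -> non_null L -> rank_two L -> lagrangian L -> minimal L ->
    forall q, L q ->
    exists (O : set 'rV[R]_(2 + 2)) (W : set 'rV[R]_2) (u : 'rV[R]_2 -> R),
      [/\ open O /\ O q,
          open W,
          [set row_mx p (grad u p) | p in W] = L `&` O
        & exists (V : 'rV[R]_2) (f1 f2 : R -> R),
            [/\ inner V V = 1,
                class_C 2 setT (f1 : R^o -> R^o),
                class_C 2 setT (f2 : R^o -> R^o),
                nonconstant f1 /\ nonconstant f2
              & forall p, W p ->
                  u p = f1 (inner p V) + f2 (inner p (jrot V))]].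
Proof.
split; first by split; [exact: pseudo_metric_GG|exact: flat_GG|exact: signature_GG].
move=> L Ls Ln Lr Ll Lm q Lq.
have [N [W [V [f1 [f2 [NP oW LN [V1 f1C f2C fn]]]]]]] :=
  minimal_lagrangian_ridges Ls Ln Lr Ll Lm Lq.
exists N, W, (fun p => f1 (inner p V) + f2 (inner p (jrot V))).
by split=> //; exists V, f1, f2.
Qed.
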